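(* Let $X$ be a Kaplansky module over $C(K)$, let $U$ be a $d$-isomorphism of $X$ with $\sigma(U)\subseteq\mathbb{T}$ (the unit circle), let $w\in C(K)$ and $T=wU$. Let $\varphi$ be the homeomorphism of $K$ onto itself such that $UfU^{-1}=f\circ\varphi$ for all $f\in C(K)$, and let $S$ be the operator on $C(K)$ defined by $(Sf)(k)=w(k)f(\varphi(k))$, $f\in C(K)$, $k\in K$. Assume that $\varphi$ has no periodic points in $K$. Then $$\sigma(T)=\sigma(S).$$
   Context: All spaces are over $\mathbb{C}$; $L(X)$ is the algebra of bounded linear operators on $X$; $\sigma$ is the spectrum. Banach $C(K)$-module: $K$ is a compact Hausdorff space, $X$ a Banach space, $m:C(K)\to L(X)$ a bounded unital homomorphism. It is always assumed that $m$ is injective and isometric and that $m(C(K))$ is closed in $L(X)$ in the weak operator topology; $f\in C(K)$ is identified with $m(f)$. For $x\in X$ the cyclic subspace $X(x)=\mathrm{cl}\{fx: f\in C(K)\}$, with the norm of $X$ and the cone $X_+(x)=\mathrm{cl}\{fx: f\in C(K), f\ge0\}$, is a (complex) Banach lattice. $X$ is a Kaplansky module if $K$ is extremally disconnected and for every $x$ the set $\{f\in C(K): fx=0\}$ is a band in $C(K)$. $d$-endomorphism: $T\in L(X)$ such that for every $x\in X$, $T(X(x))\subseteq X(Tx)$ and $T|X(x):X(x)\to X(Tx)$ is disjointness preserving ($u\perp v\Rightarrow Tu\perp Tv$). A $d$-isomorphism is an invertible $d$-endomorphism whose inverse is also a $d$-endomorphism. For a $d$-isomorphism $U$ of a Kaplansky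 module the map $f\mapsto UfU^{-1}$ is an automorphism of $C(K)$, hence induced by a homeomorphism $\varphi$ of $K$. A point $k$ is $\varphi$-periodic if $\varphi^m(k)=k$ for some $m\in\mathbb{N}$. *)

(* Defs.v *)
From HB Require Import structures.
From mathcomp Require Import all_boot all_order all_algebra.
From mathcomp Require Import complex.
From mathcomp Require Import all_classical all_reals all_analysis.

Set Implicit Arguments.
Unset Strict Implicit.
Unset Printing Implicit Defensive.

Import Order.TTheory GRing.Theory Num.Theory.
Import numFieldNormedType.Exports.

Local Open Scope classical_set_scope.
Local Open Scope ring_scope.
Local Open Scope complex_scope.

HB.mixin Record isCompactHausdorff K & Topological K := {
  compactT : compact [set: K];
  hausdorffT : hausdorff_space K
}.

#[short(type = "compactHausdorffType")]
HB.structure Definition CompactHausdorff :=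
  { K of Topological K & isCompactHausdorff K }.

Definition extremally_disconnected (K : topologicalType) : Prop :=
  forall U : set K, open U -> open (closure U).

Record homeomorphism (K L : topologicalType) := Homeomorphism {
  homeo_fun :> K -> L;
  homeo_inv : L -> K;
  homeo_funK : cancel homeo_fun homeo_inv;
  homeo_invK : cancel homeo_inv homeo_fun;
  homeo_continuous : continuous homeo_fun;
  homeo_inv_continuous : continuous homeo_inv
}.

Definition periodic_point (K : Type) (phi : K -> K) (k : K) : Prop :=
  exists2 n : nat, (0 < n)%N & iter n phi k = k.

(* The norm of a [normedModType R[i]] takes its values in [R[i]]. *)
Definition rnorm (R : realType) (V : normedModType R[i]) (x : V) : R :=
  complex.Re `|x|.

Section rnorm_theory.
Context {R : realType} {V : normedModType R[i]}.
Implicit Types x y : V.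

Lemma rnormE x : `|x| = (rnorm x)%:C.
Proof.
have : 0 <= `|x| := normr_ge0 x.
rewrite /rnorm; by case: `|x| => a b; rewrite lecE /= => /andP[/eqP -> _].
Qed.

Lemma rnorm_ge0 x : 0 <= rnorm x.
Proof. by rewrite -lecR -rnormE normr_ge0. Qed.

Lemma rnormD x y : rnorm (x + y) <= rnorm x + rnorm y.
Proof. by rewrite -lecR rmorphD /= -!rnormE ler_normD. Qed.

Lemma rnormZ (a : R[i]) x : rnorm (a *: x) = rnorm (a : R[i]^o) * rnorm x.
Proof.
apply: complexI; rewrite rmorphM /= -!rnormE; exact: normrZ.
Qed.

Lemma rnorm_eq0 x : rnorm x = 0 -> x = 0.
Proof. by move=> x0; apply/normr0_eq0; rewrite rnormE x0. Qed.

Lemma rnorm_continuous : continuous (@rnorm R V).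
Proof.
move=> x; apply/cvgrPdist_lt => e e0.
have e0' : 0 < e%:C by rewrite (ltcR 0 e).
have : \forall y \near x, `|x - y| < e%:C.
  move: e0'; apply: cvgr_dist_lt; exact: cvg_id.
apply: filterS => y xy; rewrite -ltcR; apply: le_lt_trans xy.
rewrite (_ : _%:C = `| `|x| - `|y| |); last first.
  by rewrite !rnormE -rmorphB normc_def /= expr0n addr0 sqrtr_sqr.
exact: ler_dist_dist.
Qed.

End rnorm_theory.

Definition continuous_pred (R : realType) (K : topologicalType) :
  {pred K -> R[i]^o} := [pred f | `[<continuous f>]].

Arguments continuous_pred : clear implicits.

Record CK (R : realType) (K : compactHausdorffType) := MkCK {
  CK_val : K -> R[i]^o;
  CK_mem : CK_val \in continuous_pred R K
}.

Section CK_structure.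
Context {R : realType} {K : compactHausdorffType}.

Definition CK_fun : CK R K -> K -> R[i]^o := @CK_val R K.
Coercion CK_fun : CK >-> Funclass.

HB.instance Definition _ := [isSub for @CK_val R K].
HB.instance Definition _ := [Choice of CK R K by <:].

Lemma CK_continuous (f : CK R K) : continuous f.
Proof. exact: (asboolW (CK_mem f)). Qed.

Definition mkCK (f : K -> R[i]^o) (cf : continuous f) : CK R K :=
  MkCK (asboolT cf : f \in continuous_pred R K).

Lemma CKP (f g : CK R K) : f =1 g -> f = g.
Proof. by move=> fg; apply/val_inj/funext. Qed.

Lemma continuous_subring_closed : subring_closed (continuous_pred R K).
Proof.
split=> [|f g /asboolP cf /asboolP cg|f g /asboolP cf /asboolP cg];
  apply/asboolP => x.
- exact: cvg_cst.
- by apply: cvgB; [exact: cf|exact: cg].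
- by apply: cvgM; [exact: cf|exact: cg].
Qed.

HB.instance Definition _ :=
  GRing.isSubringClosed.Build (K -> R[i]^o) (continuous_pred R K)
    continuous_subring_closed.
HB.instance Definition _ :=
  GRing.SubChoice_isSubComPzRing.Build (K -> R[i]^o) (continuous_pred R K)
    (CK R K) continuous_subring_closed.

Lemma continuous_scaler_closed : GRing.scaler_closed (continuous_pred R K).
Proof.
move=> a f /asboolP cf; apply/asboolP => x.
by apply: cvgZr; exact: cf.
Qed.

HB.instance Definition _ :=
  GRing.isScaleClosed.Build R[i] (K -> R[i]^o) (continuous_pred R K)
    continuous_scaler_closed.
HB.instance Definition _ := [SubZmodule_isSubLmodule of CK R K by <:].

Implicit Types f g : CK R K.

(* [sup set0 = 0], so this is also right for empty [K]. *)
Definition supnorm f : R := sup [set rnorm (f k) | k in [set: K]].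

Lemma supnorm_has_ub f : has_ubound [set rnorm (f k) | k in [set: K]].
Proof.
suff /compact_bounded[M [_ fM]] : compact [set rnorm (f k) | k in [set: K]].
  exists (M + 1) => r fr; apply: (le_trans (ler_norm r)).
  by apply: fM => //; rewrite ltrDl.
apply: continuous_compact; last exact: compactT.
apply: continuous_subspaceT => k; apply: continuous_comp.
  exact: CK_continuous.
exact: rnorm_continuous.
Qed.

Lemma le_supnorm f k : rnorm (f k) <= supnorm f.
Proof. by apply: ub_le_sup; [exact: supnorm_has_ub|exists k]. Qed.

Lemma supnorm_le f (M : R) :
  0 <= M -> (forall k, rnorm (f k) <= M) -> supnorm f <= M.
Proof.
move=> M0 fM; rewrite /supnorm.
have [->|/set0P f0] := eqVneq [set rnorm (f k) | k in [set: K]] set0.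
  by rewrite sup0.
by apply: ge_sup => // _ [k _ <-].
Qed.

Lemma supnorm_ge0 f : 0 <= supnorm f.
Proof.
rewrite /supnorm.
have [->|/set0P[_ [k _ _]]] := eqVneq [set rnorm (f k) | k in [set: K]] set0.
  by rewrite sup0.
exact: le_trans (rnorm_ge0 _) (le_supnorm f k).
Qed.

Let norm f : R[i] := (supnorm f)%:C.

Let ler_normD f g : norm (f + g) <= norm f + norm g.
Proof.
rewrite /norm -rmorphD lecR; apply: supnorm_le => [|k].
  by rewrite addr_ge0 ?supnorm_ge0.
by rewrite (le_trans (rnormD _ _))// lerD ?le_supnorm.
Qed.

Let supnormZ_le (a : R[i]) f :
  supnorm (a *: f) <= rnorm (a : R[i]^o) * supnorm f.
Proof.
apply: supnorm_le => [|k]; first by rewrite mulr_ge0 ?rnorm_ge0 ?supnorm_ge0.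
by rewrite (rnormZ a (f k : R[i]^o)) ler_wpM2l ?rnorm_ge0 ?le_supnorm.
Qed.

Let normrZ (a : R[i]) f : norm (a *: f) = `|a| * norm f.
Proof.
rewrite /norm (rnormE (a : R[i]^o)) -rmorphM; congr (_%:C).
apply/eqP; rewrite eq_le supnormZ_le /=.
have [->|a0] := eqVneq a 0.
  have -> : rnorm (0 : R[i]^o) = 0 by rewrite /rnorm normr0.
  by rewrite mul0r supnorm_ge0.
have ra0 : 0 < rnorm (a : R[i]^o).
  by rewrite -ltcR -rnormE normr_gt0.
rewrite -ler_pdivlMl//; have := supnormZ_le a^-1 (a *: f).
rewrite scalerA mulVf// scale1r; congr (_ <= _ * _).
apply: (mulfI (lt0r_neq0 ra0)); rewrite divff ?lt0r_neq0//.
apply: complexI; rewrite rmorphM /= -!rnormE -normrM divff//.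
by rewrite normr1.
Qed.

Let normr0_eq0 f : norm f = 0 -> f = 0.
Proof.
move=> /complexI f0; apply: CKP => k; apply: rnorm_eq0.
by apply/eqP; rewrite eq_le rnorm_ge0 -f0 le_supnorm.
Qed.

HB.instance Definition _ := Lmodule_isNormed.Build R[i] (CK R K)
  ler_normD normrZ normr0_eq0.

Lemma CK_normE f : `|f| = (supnorm f)%:C.
Proof. by []. Qed.

End CK_structure.

Lemma comp_CK_continuous (R : realType) (K : compactHausdorffType)
  (f : CK R K) (phi : homeomorphism K K) : continuous (f \o phi).
Proof.
move=> k; apply: continuous_comp; [exact: homeo_continuous|].
exact: CK_continuous.
Qed.

Definition comp_CK (R : realType) (K : compactHausdorffType)
  (f : CK R K) (phi : homeomorphism K K) : CK R K :=
  mkCK (@comp_CK_continuous R K f phi).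

Record bounded_operator (R : realType) (V W : normedModType R[i]) :=
    BoundedOperator {
  bop_fun :> {linear V -> W};
  bop_continuous : continuous bop_fun
}.

Notation "''L' ( V , W )" := (bounded_operator V W)
  (at level 8, format "''L' ( V ,  W )") : type_scope.
Notation "''L' ( V )" := (bounded_operator V V)
  (at level 8, format "''L' ( V )") : type_scope.

HB.instance Definition _ (R : realType) (V W : normedModType R[i]) :=
  gen_eqMixin 'L(V, W).
HB.instance Definition _ (R : realType) (V W : normedModType R[i]) :=
  gen_choiceMixin 'L(V, W).

Section bounded_operators.
Context {R : realType}.
Implicit Types U V W : normedModType R[i].

Lemma comp_bop_continuous U V W (S : 'L(V, W)) (T : 'L(U, V)) :
  continuous (S \o T).
Proof.
by move=> x; apply: continuous_comp; exact: bop_continuous.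
Qed.

Definition comp_bop U V W (S : 'L(V, W)) (T : 'L(U, V)) : 'L(U, W) :=
  @BoundedOperator _ _ _ (S \o T : {linear U -> W})
    (@comp_bop_continuous U V W S T).

Definition opnorm V W (T : 'L(V, W)) : R :=
  sup [set rnorm (T x) | x in [set x : V | `|x| <= 1]].

Definition bop_inverse V (T S : 'L(V)) : Prop := cancel T S /\ cancel S T.

Definition resolvent_set V (T : 'L(V)) : set R[i] :=
  [set lambda | exists S : 'L(V),
    (forall x, S (T x - lambda *: x) = x) /\
    (forall x, T (S x) - lambda *: S x = x)].

Definition spectrum V (T : 'L(V)) : set R[i] := ~` resolvent_set T.

(* The weak operator topology is the initial topology of this map. *)
Definition wot_eval V (T : 'L(V)) :
  {ptws V * 'L(V, R[i]^o) -> R[i]^o} := fun p => p.2 (T p.1).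

Definition wot_closed V (A : set 'L(V)) : Prop :=
  closed (A : set (initial_topology (@wot_eval V))).

End bounded_operators.

(* The real part of a complex Banach lattice with positive cone [P] is
   [P - P], ordered by [u <= v] iff [v - u] is in [P]. *)
Section complex_lattice.
Context {R : realType} {V : lmodType R[i]}.
Variable P : set V.
Implicit Types u v r s : V.

Definition cone_le u v : Prop := P (v - u).

Definition real_part : set V := [set p - q | p in P & q in P].

Definition is_supremum (A : set V) s : Prop :=
  [/\ real_part s, forall a, A a -> cone_le a s &
   forall t, real_part t -> (forall a, A a -> cone_le a t) -> cone_le s t].

Definition is_infimum (A : set V) s : Prop :=
  [/\ real_part s, forall a, A a -> cone_le s a &
   forall t, real_part t -> (forall a, A a -> cone_le t a) -> cone_le t s].

(* |a + ib| = sup_t ((cos t) a + (sin t) b) for [a], [b] in the real part. *)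
Definition is_modulus u r : Prop :=
  exists a b, [/\ real_part a, real_part b, u = a + 'i *: b &
    is_supremum [set (cos t)%:C *: a + (sin t)%:C *: b | t in [set: R]] r].

(* |u| /\ |v| = 0 *)
Definition lattice_disjoint u v : Prop :=
  exists r s, [/\ is_modulus u r, is_modulus v s & is_infimum [set r; s] 0].

End complex_lattice.

Section CK_bands.
Context {R : realType} {K : compactHausdorffType}.

(* In [R[i]], [0 <= z] means that [z] is real and nonnegative. *)
Definition CK_nonneg : set (CK R K) := [set f : CK R K | forall k, 0 <= f k].

(* A band is a solid linear subspace containing the supremum of each of its
   subsets of real functions that has a supremum in C(K). *)
Definition CK_band (B : set (CK R K)) : Prop :=
  [/\ B 0,
      forall (a : R[i]) f g, B f -> B g -> B (a *: f + g),
      forall f (g : CK R K), B f -> (forall k, `|g k| <= `|f k|) -> B g &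
      forall (A : set (CK R K)) f, A `<=` B `&` real_part CK_nonneg ->
        is_supremum CK_nonneg A f -> B f].

End CK_bands.

Record CK_module (R : realType) (K : compactHausdorffType)
    (X : completeNormedModType R[i]) := CKModule {
  ckact :> CK R K -> 'L(X);
  ckactD : forall f g x, ckact (f + g) x = ckact f x + ckact g x;
  ckactZ : forall (a : R[i]) f x, ckact (a *: f) x = a *: ckact f x;
  ckactM : forall f g x, ckact (f * g) x = ckact f (ckact g x);
  ckact1 : forall x, ckact 1 x = x;
  ckact_bounded : exists M : R, forall f, opnorm (ckact f) <= M * supnorm f;
  ckact_inj : injective ckact;
  ckact_isometric : forall f, opnorm (ckact f) = supnorm f;
  ckact_wot_closed : wot_closed (range ckact)
}.

Section module_notions.
Context {R : realType} {K : compactHausdorffType}.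
Context {X : completeNormedModType R[i]} (m : CK_module K X).

Definition cyclic_subspace (x : X) : set X :=
  closure [set m f x | f in [set: CK R K]].

Definition cyclic_cone (x : X) : set X :=
  closure [set m f x | f in @CK_nonneg R K].

Definition Kaplansky_module : Prop :=
  extremally_disconnected K /\
  forall x : X, CK_band [set f : CK R K | m f x = 0].

Definition cyclic_disjoint (x u v : X) : Prop :=
  [/\ cyclic_subspace x u, cyclic_subspace x v &
   lattice_disjoint (cyclic_cone x) u v].

Definition d_endomorphism (T : 'L(X)) : Prop :=
  forall x : X,
    (forall u, cyclic_subspace x u -> cyclic_subspace (T x) (T u)) /\
    (forall u v, cyclic_disjoint x u v -> cyclic_disjoint (T x) (T u) (T v)).

Definition d_isomorphism (U : 'L(X)) : Prop :=
  d_endomorphism U /\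
  exists2 V : 'L(X), bop_inverse U V & d_endomorphism V.

End module_notions.

Section weighted_composition.
Context {R : realType} {K : compactHausdorffType}.
Variables (w : CK R K) (phi : homeomorphism K K).

Definition wcomp_fun (f : CK R K) : CK R K := w * comp_CK f phi.

Lemma wcomp_funE f k : wcomp_fun f k = w k * f (phi k).
Proof. by []. Qed.

Lemma wcomp_linear : linear wcomp_fun.
Proof.
move=> a f g; apply: CKP => k.
change (w k * (a * f (phi k) + g (phi k)) =
  a * (w k * f (phi k)) + w k * g (phi k)).
by rewrite mulrDr mulrCA.
Qed.

HB.instance Definition _ :=
  GRing.isLinear.Build R[i] (CK R K) (CK R K) _ wcomp_fun wcomp_linear.

Lemma wcomp_continuous : continuous wcomp_fun.
Proof.
apply: bounded_linear_continuous; apply/linear_boundedP.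
near=> r => f.
apply: (@le_trans _ _ (`|w| * `|f|)).
  rewrite !CK_normE -rmorphM lecR; apply: supnorm_le => [|k].
    by rewrite mulr_ge0 ?supnorm_ge0.
  rewrite wcomp_funE (rnormZ (w k) (f (phi k))).
  by rewrite ler_pM ?rnorm_ge0 ?le_supnorm.
rewrite ler_wpM2r//; near: r; apply: nbhs_pinfty_ge.
Unshelve. all: by end_near. Qed.

Definition wcomp : 'L(CK R K) := BoundedOperator wcomp_continuous.

End weighted_composition.

(* Main.v *)
(* The module [X] and [C(K)] itself are two instances of one situation: [C(K)] acts
   contractively and faithfully on [V], [U f U^-1 = f o phi], and [U], [U^-1] have
   subexponentially growing powers (for [X] by the spectral radius formula). In this
   situation, membership of [l] in the resolvent set of [T = w U] is characterized by [w] and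
   [phi] only. If [l = 0] the condition is that [w] has no zero. If [l <> 0], rescale to
   [l = 1]; the condition is a dichotomy for the cocycle
   [w_n k = w(k) w(phi k) ... w(phi^(n-1) k)]: there is a clopen [phi]-invariant set on which
   [w_n] decays exponentially and off which it grows exponentially.

   The dichotomy gives the inverse of [T - 1] as two Neumann series. Conversely, let [T - 1] be
   invertible and let [x] be supported in a clopen set [D] with
   [D, phi^-1 D, ..., phi^-N D] disjoint, which exists near every point since [phi] has no
   periodic points. Boundedness below of [T - 1], tested on [sum_j r^|j-m| T^j x], shows that
   [|T^m x|] is exponentially small compared with the values at the two ends of the orbit, so
   at each point [w_m] is small forwards or large backwards. Solving [T y - y = x] and
   localizing [y] to the sets [phi^-j D] shows that both cannot hold. *)
From HB Require Import structures.
Require Import Defs.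
From mathcomp Require Import all_boot all_order all_algebra.
From mathcomp Require Import complex.
From mathcomp Require Import all_classical all_reals all_analysis.
From mathcomp Require Import cyclic separable cyclotomic.
From mathcomp Require Import ring lra.

Set Implicit Arguments.
Unset Strict Implicit.
Unset Printing Implicit Defensive.

Import Order.TTheory GRing.Theory Num.Theory.
Import numFieldNormedType.Exports.

Local Open Scope classical_set_scope.
Local Open Scope ring_scope.
Local Open Scope complex_scope.

(** * Bounded operators and the real-valued norm *)

Section rnorm_lemmas.
Context {R : realType} {V : normedModType R[i]}.
Implicit Types (x y : V) (a : R[i]).

Lemma rnorm0 : rnorm (0 : V) = 0.
Proof. by rewrite /rnorm normr0. Qed.

Lemma rnormN x : rnorm (- x) = rnorm x.
Proof. by rewrite /rnorm normrN. Qed.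

Lemma rnormB x y : rnorm (x - y) <= rnorm x + rnorm y.
Proof. by rewrite -(rnormN y) rnormD. Qed.

Lemma rnorm_lerB x y : rnorm x - rnorm y <= rnorm (x - y).
Proof. by rewrite lerBlDr -{1}(subrK y x) rnormD. Qed.

Lemma rnorm_gt0 x : (0 < rnorm x) = (x != 0).
Proof.
rewrite lt_neqAle rnorm_ge0 andbT; congr (~~ _).
by apply/eqP/eqP => [/esym/rnorm_eq0|->]; rewrite ?rnorm0.
Qed.

Lemma rnorm_sum (I : Type) (s : seq I) (P : pred I) (F : I -> V) :
  rnorm (\sum_(i <- s | P i) F i) <= \sum_(i <- s | P i) rnorm (F i).
Proof.
elim/big_ind2 : _ => [|x1 x2 y1 y2 h1 h2|//]; first by rewrite rnorm0.
exact: le_trans (rnormD _ _) (lerD h1 h2).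
Qed.

Lemma ler_rnorm x (r : R) : (rnorm x <= r) = (`|x| <= r%:C).
Proof. by rewrite rnormE lecR. Qed.

Lemma ltr_rnorm x (r : R) : (rnorm x < r) = (`|x| < r%:C).
Proof. by rewrite rnormE ltcR. Qed.

End rnorm_lemmas.

Section rnorm_scalars.
Context {R : realType}.
Implicit Types a b : R[i].

Lemma rnormM a b : rnorm (a * b : R[i]^o) = rnorm (a : R[i]^o) * rnorm (b : R[i]^o).
Proof. exact: (rnormZ a (b : R[i]^o)). Qed.

Lemma rnorm1 : rnorm (1 : R[i]^o) = 1.
Proof. by rewrite /rnorm normr1. Qed.

Lemma rnormV a : rnorm (a^-1 : R[i]^o) = (rnorm (a : R[i]^o))^-1.
Proof.
have [->|a0] := eqVneq a 0; first by rewrite invr0 rnorm0 invr0.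
have ra : rnorm (a : R[i]^o) != 0 by rewrite gt_eqF// rnorm_gt0.
by apply: (mulfI ra); rewrite -rnormM !divff// rnorm1.
Qed.

Lemma rnormX a n : rnorm (a ^+ n : R[i]^o) = rnorm (a : R[i]^o) ^+ n.
Proof. by elim: n => [|n IH]; rewrite ?expr0 ?rnorm1// !exprS rnormM IH. Qed.

Lemma rnorm_real (r : R) : rnorm (r%:C : R[i]^o) = `|r|.
Proof. by rewrite /rnorm normc_def /= expr0n addr0 sqrtr_sqr. Qed.

End rnorm_scalars.

Section bounded_linear.
Context {R : realType} {V W : normedModType R[i]}.

Lemma linear_rbounded_continuous (f : {linear V -> W}) (C : R) :
  (forall x, rnorm (f x) <= C * rnorm x) -> continuous f.
Proof.
move=> fC; apply: bounded_linear_continuous; apply/linear_boundedP.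
near=> r => x.
have -> : `|f x| = (rnorm (f x))%:C by exact: rnormE.
apply: (@le_trans _ _ (C%:C * `|x|)).
  by rewrite rnormE -rmorphM lecR.
rewrite ler_wpM2r//; near: r; apply: nbhs_pinfty_ge.
by rewrite complex_real.
Unshelve. all: by end_near. Qed.

Lemma bop_bounded (T : 'L(V, W)) :
  exists2 C : R, 0 < C & forall x, rnorm (T x) <= C * rnorm x.
Proof.
have : \forall r \near +oo, forall x, `|T x| <= r * `|x|.
  by apply/linear_boundedP/continuous_linear_bounded; exact: bop_continuous.
move=> [M [Mreal TM]].
pose r : R := `|complex.Re M| + 1.
have Mr : M < r%:C.
  by rewrite -[M]RRe_real// ltcR /r ltr_pwDr// ler_norm.
exists r => [|x]; first by rewrite /r ltr_wpDl.
by rewrite -lecR rmorphM /= -!rnormE TM.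
Qed.

End bounded_linear.

(** Conversely, the lower bound makes [T - l] injective, so a chosen right inverse is linear and
    two-sided, and the same bound makes it continuous. Invertibility is thus reduced to one estimate
    and one solvability statement. *)
Lemma resolvent_setP (R : realType) (V : normedModType R[i]) (T : 'L(V)) (l : R[i]) :
  resolvent_set T l <->
  (exists2 C : R, 0 < C & forall x, rnorm x <= C * rnorm (T x - l *: x)) /\
  (forall y, exists x, T x - l *: x = y).
Proof.
split=> [[S [ST TS]]|[[C C0 TC] Ts]].
  split; last by move=> y; exists (S y).
  have [C C0 SC] := bop_bounded S.
  by exists C => // x; rewrite -{1}(ST x).
have [S TS] := choice Ts.
have inj x y : T x - l *: x = T y - l *: y -> x = y.
  move=> xy; apply/eqP; rewrite -subr_eq0; apply/eqP/rnorm_eq0/eqP.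
  rewrite eq_le rnorm_ge0 andbT (le_trans (TC _))// linearB scalerBr.
  have -> : T x - T y - (l *: x - l *: y) = (T x - l *: x) - (T y - l *: y).
    by rewrite !opprB addrACA [RHS]addrACA [- T y + _]addrC.
  by rewrite xy subrr rnorm0 mulr0.
have Slin : linear S.
  move=> a x y; apply: inj; rewrite TS linearP scalerDr opprD addrACA.
  by rewrite scalerA mulrC -scalerA -scalerBr !TS.
pose S1 := HB.pack S (GRing.isLinear.Build _ _ _ _ S Slin) : {linear V -> V}.
have cS : continuous S1.
  apply: (@linear_rbounded_continuous _ _ _ _ C) => x.
  by rewrite (le_trans (TC _))// TS.
exists (BoundedOperator cS); split=> x //=.
by apply: inj; rewrite TS.
Qed.

(** * Powers of operators and roots of unity *)

Lemma idfun_continuous (S : topologicalType) : continuous (idfun : S -> S).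
Proof. by move=> x; exact: cvg_id. Qed.

Lemma exp_le (R : numDomainType) (x y : R) n : 0 <= x -> x <= y -> x ^+ n <= y ^+ n.
Proof.
by move=> x0 xy; apply: (lerXn2r n _ _ xy); rewrite nnegrE ?(le_trans x0).
Qed.

Section powers.
Context {R : realType} {V : normedModType R[i]}.
Implicit Types (T : 'L(V)) (r s : R).

Fixpoint bpow T n : 'L(V) :=
  if n is m.+1 then comp_bop T (bpow T m)
  else @BoundedOperator _ _ _ (idfun : {linear V -> V}) (@idfun_continuous V).

Lemma bpowS T n x : bpow T n.+1 x = T (bpow T n x).
Proof. by []. Qed.

Lemma bpowD T m n x : bpow T (m + n) x = bpow T m (bpow T n x).
Proof. by elim: m => // m IH; rewrite addSn !bpowS IH. Qed.

Lemma bpowSr T n x : bpow T n.+1 x = bpow T n (T x).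
Proof. by rewrite -addn1 bpowD. Qed.

Definition growth T r : Prop := exists2 C : R, 0 < C &
  forall n x, rnorm (bpow T n x) <= C * r ^+ n * rnorm x.

(** Equivalently, the spectral radius $\lim\|T^n\|^{1/n}$ is at most 1. *)
Definition subexponential T : Prop := forall r, 1 < r -> growth T r.

Lemma growth_le T r s : 0 <= r -> r <= s -> growth T r -> growth T s.
Proof.
move=> r0 rs [C C0 Tr]; exists C => // n x; rewrite (le_trans (Tr n x))//.
by rewrite ler_wpM2r ?rnorm_ge0// ler_wpM2l ?exp_le// ltW.
Qed.

Lemma growth_bound T : exists2 r, 0 < r & growth T r.
Proof.
have [C C0 TC] := bop_bounded T.
exists C => //; exists 1; [exact: ltr01|move=> n x; rewrite mul1r].
elim: n => [|n IH]; first by rewrite expr0 mul1r.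
by rewrite bpowS (le_trans (TC _))// exprS -mulrA ler_wpM2l// ltW.
Qed.

(** Division of the exponent by [n] with remainder: the quotient gives the exact rate, and the
    remainder, bounded by a crude rate [s], only enters the constant through $s\le tr$. *)
Lemma growth_of_power T n r : (0 < n)%N -> 0 < r ->
  (forall x, rnorm (bpow T n x) <= r ^+ n * rnorm x) -> growth T r.
Proof.
move=> n0 r0 Tn.
have [s s0 [C C0 TC]] := growth_bound T.
pose t := Num.max 1 (s / r).
have t1 : 1 <= t by rewrite le_max lexx.
have Tmul q x : rnorm (bpow T (q * n) x) <= r ^+ (q * n) * rnorm x.
  elim: q x => [|q IH] x; first by rewrite mul0n expr0 mul1r.
  rewrite mulSn bpowD (le_trans (Tn _))// exprD -mulrA ler_wpM2l//.
  by rewrite exprn_ge0 ?ltW.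
exists (C * t ^+ n) => [|k x]; first by rewrite mulr_gt0// exprn_gt0// (lt_le_trans ltr01 t1).
rewrite {1}(divn_eq k n) bpowD (le_trans (Tmul _ _))//.
have str : s <= t * r by rewrite -ler_pdivrMr// le_max lexx orbT.
have sm : s ^+ (k %% n) <= t ^+ n * r ^+ (k %% n).
  apply: (@le_trans _ _ ((t * r) ^+ (k %% n))).
    by rewrite exp_le// ltW.
  rewrite exprMn ler_wpM2r ?exprn_ge0 ?(ltW r0)//; apply: (ler_weXn2l t1).
  by rewrite ltnW// ltn_pmod.
rewrite [in X in _ <= X](divn_eq k n) exprD.
have := TC (k %% n)%N x => hu.
apply: (@le_trans _ _ (r ^+ (k %/ n * n) * (C * (t ^+ n * r ^+ (k %% n)) * rnorm x))).
  rewrite ler_wpM2l ?exprn_ge0 ?(ltW r0)// (le_trans hu)// ler_wpM2r ?rnorm_ge0//.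
  by rewrite ler_wpM2l// (ltW C0).
by rewrite le_eqVlt; apply/orP; left; apply/eqP; ring.
Qed.

Lemma pow_dominated (C r s : R) : 0 < r -> r < s ->
  forall e, 0 < e -> exists N, forall n, (N <= n)%N -> C * r ^+ n <= e * s ^+ n.
Proof.
move=> r0 rs e e0.
have s0 := lt_trans r0 rs.
have : \forall n \near \oo, `|0 - C * (r / s) ^+ n| < e.
  have : (geometric C (r / s)) @ \oo --> 0.
    by apply: cvg_geometric; rewrite gtr0_norm ?divr_gt0// ltr_pdivrMr ?mul1r.
  move=> /cvgrPdist_lt; apply => //.
move=> [N _ NP]; exists N => n /NP; rewrite sub0r normrN => /ltW/(le_trans (ler_norm _)).
by rewrite expr_div_n mulrA ler_pdivrMr ?exprn_gt0.
Qed.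

End powers.

Section roots_of_unity.
Context {R : realType}.

Lemma complex_prim_root n : (0 < n)%N -> exists z : R[i], n.-primitive_root z.
Proof.
move=> n0; have [r] := closed_field_poly_normal ('X^n - 1 : {poly R[i]}).
rewrite (monicP (monicXnsubC 1 n0)) scale1r => pr.
have rn1 : all n.-unity_root r.
  by apply/allP => z; rewrite -root_prod_XsubC -pr.
have sr : (n < (size r).+1)%N.
  by rewrite -(size_prod_XsubC r id) -pr size_XnsubC.
have ur : uniq r.
  by rewrite -separable_prod_XsubC -pr separable_Xn_sub_1// pnatr_eq0 -lt0n.
by have /hasP[z _ zn] := has_prim_root n0 rn1 ur sr; exists z.
Qed.

Lemma prim_root_rnorm n (z : R[i]) : n.-primitive_root z -> rnorm (z : R[i]^o) = 1.
Proof.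
move=> zn; have := congr1 (fun u : R[i] => rnorm (u : R[i]^o)) (prim_expr_order zn).
rewrite rnormX rnorm1 => /eqP.
by rewrite pexpr_eq1 ?rnorm_ge0 ?(prim_order_gt0 zn)// => /eqP.
Qed.

Lemma prim_root_sum n (z : R[i]) m : n.-primitive_root z -> (0 < m < n)%N ->
  \sum_(i < n) (z ^+ i) ^+ m = 0.
Proof.
move=> zn /andP[m0 mn].
have zm : z ^+ m != 1.
  by rewrite -(prim_order_dvd zn) gtnNdvd.
under eq_bigr do rewrite exprAC.
apply: (mulfI (_ : z ^+ m - 1 != 0)); first by rewrite subr_eq0.
by rewrite -subrX1 mulr0 exprAC (prim_expr_order zn) expr1n subrr.
Qed.

End roots_of_unity.

(** * Factoring $T^n-l^n$ through $T-l$ *)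

Section geometric_operator.
Context {R : realType} {V : normedModType R[i]}.
Variable T : 'L(V).
Implicit Types (l : R[i]) (x y : V).

(** The quotient $(T^n-l^n)/(T-l)$ applied to [x]. *)
Definition pgeom l n x : V := \sum_(j < n) l ^+ (n - j.+1) *: bpow T j x.

Lemma pgeom_root l n x : T (pgeom l n x) - l *: pgeom l n x =
  bpow T n x - l ^+ n *: x.
Proof.
rewrite /pgeom linear_sum scaler_sumr -sumrB.
pose f j := l ^+ (n - j) *: bpow T j x.
rewrite (eq_bigr (fun j : 'I_n => f j.+1 - f j)) => [|j _].
  rewrite -(big_mkord xpredT (fun j => f j.+1 - f j)) telescope_sumr// /f.
  by rewrite subnn subn0 expr0 scale1r.
by rewrite /f linearZ /= scalerA -exprS subnSK.
Qed.

Lemma pgeom_sub l n y : pgeom l n (T y - l *: y) = bpow T n y - l ^+ n *: y.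
Proof.
rewrite -pgeom_root /pgeom linear_sum scaler_sumr -sumrB; apply: eq_bigr => j _.
rewrite linearB scalerBr linearZ -bpowSr bpowS !linearZ /=.
by rewrite !scalerA mulrC.
Qed.

(** The coefficient of $T^jx$ is $s^{n-j}\sum_i z^{i(n-j)}$, which vanishes unless $j=0$. Divided by
    $n(T^n-s^n)$, the identity is the partial fraction expansion of $s^n/(T^n-s^n)$. *)
Lemma pgeom_sum n (z s : R[i]) x : n.-primitive_root z ->
  \sum_(i < n) (s * z ^+ i) *: pgeom (s * z ^+ i) n x = (n%:R * s ^+ n) *: x.
Proof.
move=> zn; rewrite /pgeom.
under eq_bigr do rewrite scaler_sumr.
rewrite exchange_big /=.
under eq_bigr => j _.
  under eq_bigr => i _ do rewrite scalerA -exprS subnSK// exprMn.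
  rewrite -scaler_suml -mulr_sumr.
  over.
have := prim_order_gt0 zn; case: n zn => // n zn _.
rewrite big_ord_recl [X in _ + X]big1 ?addr0 => [|j _]; last first.
  rewrite (prim_root_sum zn) ?mulr0 ?scale0r// lift0 subSS.
  by rewrite subn_gt0 ltn_ord /= ltnS leq_subr.
rewrite subn0; congr (_ *: _).
rewrite (eq_bigr (fun=> 1)); first by rewrite sumr_const card_ord mulrC.
by move=> i _; rewrite exprAC (prim_expr_order zn) expr1n.
Qed.

End geometric_operator.

(** * The spectral radius *)

Lemma rnorm_dist (R : realType) (V : normedModType R[i]) (x y : V) :
  `|rnorm x - rnorm y| <= rnorm (x - y).
Proof.
have h1 := rnorm_lerB x y; have := rnorm_lerB y x.
by rewrite -[rnorm (y - x)]rnormN opprB ler_norml h1 andbT => h2; lra.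
Qed.

Section annulus.
Context {R : realType} {V : normedModType R[i]}.
Variable T : 'L(V).

Definition resolvent_bound (C : R) (l : R[i]) : Prop :=
  forall x, rnorm x <= C * rnorm (T x - l *: x).

Lemma near_complex (p : R * R) (e : R) : 0 < e ->
  \forall q \near p, rnorm ((q.1 +i* q.2) - (p.1 +i* p.2) : R[i]^o) < e.
Proof.
move=> e0; near=> q.
have -> : (q.1 +i* q.2) - (p.1 +i* p.2) =
    (q.1 - p.1)%:C + 'i * (q.2 - p.2)%:C :> R[i].
  by apply/eqP; rewrite eq_complex /= !(mul0r, mul1r, mulr0, subr0, addr0, add0r) !eqxx.
rewrite (le_lt_trans (rnormD _ _))// rnormM !rnorm_real.
have -> : rnorm ('i : R[i]^o) = 1 by rewrite /rnorm normCi.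
rewrite mul1r (splitr e) ltrD//.
  near: q; have /cvgrPdist_lt/(_ (e / 2)) : fst @ nbhs p --> p.1 by exact: cvg_fst.
  rewrite divr_gt0// => /(_ isT); apply: filterS => q; by rewrite distrC.
near: q; have /cvgrPdist_lt/(_ (e / 2)) : snd @ nbhs p --> p.2 by exact: cvg_snd.
by rewrite divr_gt0// => /(_ isT); apply: filterS => q; rewrite distrC.
Unshelve. all: by end_near. Qed.

(** The perturbation $(l'-l)x$ costs at most half of [rnorm x], which is absorbed on the left. *)
Lemma resolvent_bound_near (C : R) (l l' : R[i]) : 0 < C ->
  rnorm (l' - l : R[i]^o) <= (2 * C)^-1 ->
  resolvent_bound C l -> resolvent_bound (2 * C) l'.
Proof.
move=> C0 ll TC x.
have h : rnorm (T x - l *: x) <= rnorm (T x - l' *: x) + (2 * C)^-1 * rnorm x.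
  have -> : T x - l *: x = (T x - l' *: x) + (l' - l) *: x.
    by rewrite scalerBl addrA subrK.
  by rewrite (le_trans (rnormD _ _))// lerD2l rnormZ ler_wpM2r ?rnorm_ge0.
have := le_trans (TC x) (ler_wpM2l (ltW C0) h).
have -> : (2 * C)^-1 = C^-1 / 2 by rewrite invfM mulrC.
rewrite mulrDr !mulrA divff ?gt_eqF// mul1r.
lra.
Qed.

Lemma resolvent_bound_le (C D : R) l : C <= D -> resolvent_bound C l -> resolvent_bound D l.
Proof. by move=> CD TC x; rewrite (le_trans (TC x))// ler_wpM2r ?rnorm_ge0. Qed.

(** Each lower bound persists nearby, and compactness of a square containing the annulus yields a
    single constant. A point off the annulus has a neighbourhood off it, where [P] holds
    vacuously. *)
Lemma resolvent_bound_annulus (a b : R) :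
  (forall l, a <= rnorm (l : R[i]^o) <= b -> resolvent_set T l) ->
  exists2 C, 0 < C & forall l, a <= rnorm (l : R[i]^o) <= b -> resolvent_bound C l.
Proof.
move=> Tab.
have /compact_near_coveringP cQ : compact (`[-b, b]%classic `*` `[-b, b]%classic : set (R * R)).
  by apply: compact_setX; exact: segment_compact.
pose P (C : R) (p : R * R) :=
  a <= rnorm (p.1 +i* p.2 : R[i]^o) <= b -> resolvent_bound C (p.1 +i* p.2).
have := cQ _ (+oo%R : set_system R) P _.
have Pnear p : (`[-b, b]%classic `*` `[-b, b]%classic) p ->
    \forall x' \near p & i \near +oo%R, P i x'.
  move=> _; have [pab|pab] := boolP (a <= rnorm (p.1 +i* p.2 : R[i]^o) <= b).
    have /resolvent_setP[[C C0 TC] _] := Tab _ pab.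
    exists ([set q : R * R | rnorm ((q.1 +i* q.2) - (p.1 +i* p.2) : R[i]^o) < (2 * C)^-1],
            [set D | 2 * C <= D]) => /=.
      split; last by apply: nbhs_pinfty_ge; rewrite num_real.
      by apply: near_complex; rewrite invr_gt0 mulr_gt0.
    move=> [q D] [/= pq CD] _; apply: (resolvent_bound_le CD).
    exact: resolvent_bound_near C0 (ltW pq) TC.
  pose N := rnorm (p.1 +i* p.2 : R[i]^o).
  have [e e0 eP] : exists2 e, 0 < e & forall t, `|t - N| < e -> ~~ (a <= t <= b).
    move: pab; rewrite -/N negb_and -!ltNge => /orP[Na|Nb].
      exists (a - N) => [|t]; rewrite ?subr_gt0// => tN; rewrite negb_and -!ltNge.
      by have := le_lt_trans (ler_norm _) tN; rewrite ltrBlDr subrK => ->.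
    exists (N - b) => [|t]; rewrite ?subr_gt0// distrC => tN; rewrite negb_and -!ltNge.
    have := le_lt_trans (ler_norm _) tN; rewrite ltrBlDl addrC -ltrBlDl opprB addrCA subrr addr0.
    by move=> ->; rewrite orbT.
  exists ([set q : R * R | rnorm ((q.1 +i* q.2) - (p.1 +i* p.2) : R[i]^o) < e], setT) => /=.
    by split; [exact: near_complex|exact: filterT].
  move=> [q D] [/= pq _]; rewrite /P => qab; exfalso.
  move: qab; apply/negP; apply: eP; apply: le_lt_trans pq.
  exact: rnorm_dist.
move=> /(_ _ Pnear) [M [_ MP]].
exists (`|M| + 1); first by rewrite ltr_wpDl.
move=> [l1 l2] /[dup] /andP[_ lb] lab; apply: (MP _ _ (l1, l2)) => //=.
  by rewrite (le_lt_trans (ler_norm _))// ltrDl.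
split=> /=; rewrite in_itv /= -ler_norml; apply: le_trans lb; rewrite /rnorm normc_def /=.
  by rewrite -sqrtr_sqr ler_wsqrtr// lerDl sqr_ge0.
by rewrite -sqrtr_sqr ler_wsqrtr// lerDr sqr_ge0.
Qed.

End annulus.

Section spectral_radius.
Context {R : realType} {V : normedModType R[i]}.
Variable T : 'L(V).

(* With [z^i] the [n]-th roots of unity and [y_i] the solution of [(T - s z^i) y_i = u], the
   average of the [s z^i y_i] solves [(T^n - s^n) y = s^n u]; for [s'] it is [x] itself. The
   bound on the difference does not depend on [n]. *)
Lemma resolvent_average (a b C s s' : R) n x : (0 < n)%N ->
  (forall l, a <= rnorm (l : R[i]^o) <= b -> resolvent_set T l) ->
  (forall l, a <= rnorm (l : R[i]^o) <= b -> resolvent_bound T C l) ->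
  0 <= C -> 0 < a -> a <= s <= b -> a <= s' <= b ->
  let u := ((s' ^+ n)%:C)^-1 *: bpow T n x - x in
  exists y, bpow T n y - (s ^+ n)%:C *: y = (s ^+ n)%:C *: u /\
    rnorm (y - x) <= (b * C ^+ 2 + C) * `|s - s'| * rnorm u.
Proof.
move=> n0 Tres TC C0 a0 sab sab' u.
have [z zn] := complex_prim_root (R := R) n0.
have zr := prim_root_rnorm zn.
have [s0 s'0] : 0 < s /\ 0 < s' by lra.
have b0 : 0 < b by lra.
pose l (t : R) (i : nat) : R[i] := t%:C * z ^+ i.
have rl t i : 0 < t -> rnorm (l t i : R[i]^o) = t.
  by move=> t0; rewrite rnormM rnorm_real rnormX zr expr1n mulr1 gtr0_norm.
have lX t i : l t i ^+ n = (t ^+ n)%:C.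
  by rewrite exprMn exprAC (prim_expr_order zn) expr1n mulr1 rmorphXn.
(* At radius [s'] the equation $(T-l)y=u$ has an explicit solution, because $u=s'^{-n}(T^n-s'^n)x$
   and $T-l$ is a factor of $T^n-s'^n$. *)
pose y' (i : 'I_n) := ((s' ^+ n)%:C)^-1 *: pgeom T (l s' i) n x.
have s'n : (s' ^+ n)%:C != 0 :> R[i] by rewrite gt_eqF// ltcR exprn_gt0.
have sn : (s ^+ n)%:C != 0 :> R[i] by rewrite gt_eqF// ltcR exprn_gt0.
have nn : n%:R != 0 :> R[i] by rewrite pnatr_eq0 -lt0n.
have Ty' i : T (y' i) - l s' i *: y' i = u.
  rewrite linearZ /= scalerA mulrC -scalerA -scalerBr pgeom_root lX scalerBr.
  by rewrite scalerA mulVf// scale1r.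
have sumy' : \sum_(i < n) l s' i *: y' i = n%:R *: x.
  under eq_bigr do rewrite scalerA mulrC -scalerA.
  rewrite -scaler_sumr (pgeom_sum T _ x zn) scalerA -rmorphXn /=.
  by rewrite mulrCA mulVf// mulr1.
have /choice[y Ty] : forall i : 'I_n, exists y, T y - l s i *: y = u.
  move=> i; have /resolvent_setP[_] : resolvent_set T (l s i) by apply: Tres; rewrite rl.
  exact.
exists (n%:R^-1 *: \sum_(i < n) l s i *: y i); split.
  rewrite linearZ linear_sum scalerA mulrC -scalerA -scalerBr scaler_sumr -sumrB.
  have -> : \sum_(i < n) (bpow T n (l s i *: y i) - (s ^+ n)%:C *: (l s i *: y i)) =
      \sum_(i < n) l s i *: pgeom T (l s i) n u.
    apply: eq_bigr => i _; rewrite -(Ty i) pgeom_sub lX linearZ /= scalerBr.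
    by rewrite !scalerA mulrC.
  by rewrite (pgeom_sum T _ u zn) scalerA mulrA mulVf// mul1r rmorphXn.
have -> : n%:R^-1 *: (\sum_(i < n) l s i *: y i) - x =
    n%:R^-1 *: \sum_(i < n) (l s i *: y i - l s' i *: y' i).
  by rewrite sumrB sumy' scalerBr scalerA mulVf// scale1r.
rewrite rnormZ rnormV.
have -> : rnorm (n%:R : R[i]^o) = n%:R.
  by rewrite -(rmorph_nat (real_complex R)) rnorm_real ger0_norm.
rewrite ler_pdivrMl ?ltr0n// (le_trans (rnorm_sum _ _ _))//.
set e := (X in _ <= _ * X).
have -> : n%:R * e = \sum_(i < n) e by rewrite sumr_const card_ord mulr_natl.
apply: ler_sum => i _.
have dl : rnorm (l s i - l s' i : R[i]^o) = `|s - s'|.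
  by rewrite -mulrBl -rmorphB rnormM rnorm_real rnormX zr expr1n mulr1.
have y'le : rnorm (y' i) <= C * rnorm u by rewrite -(Ty' i) TC// rl.
(* Resolvent identity: $y_i-y'_i$ solves the equation at radius [s] with right side $(l-l')y'_i$.
   Two uses of the lower bound give the term $bC^2$, and the change of the factor gives the term
   $C$. *)
have -> : l s i *: y i - l s' i *: y' i =
    l s i *: (y i - y' i) + (l s i - l s' i) *: y' i.
  by rewrite scalerBr scalerBl addrA subrK.
have dle : rnorm (y i - y' i) <= C * (`|s - s'| * (C * rnorm u)).
  have TCs : resolvent_bound T C (l s i) by apply: TC; rewrite rl.
  rewrite (le_trans (TCs _))// ler_wpM2l//.
  have -> : T (y i - y' i) - l s i *: (y i - y' i) = (l s i - l s' i) *: y' i.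
    have Tyi : T (y i) = u + l s i *: y i by rewrite -(Ty i) subrK.
    have Ty'i : T (y' i) = u + l s' i *: y' i by rewrite -(Ty' i) subrK.
    rewrite linearB Tyi Ty'i scalerBr scalerBl opprD addrACA subrr add0r opprB.
    by rewrite [LHS]addrC addrA subrK.
  by rewrite rnormZ dl ler_wpM2l.
rewrite (le_trans (rnormD _ _))// (rnormZ (l s i)) (rnormZ (l s i - l s' i)) rl// dl.
rewrite /e mulrDl mulrDl lerD//.
  apply: (@le_trans _ _ (b * (C * (`|s - s'| * (C * rnorm u))))).
    have /andP[_ sb] := sab.
    by rewrite ler_pM ?rnorm_ge0 ?(ltW s0).
  by rewrite le_eqVlt; apply/orP; left; apply/eqP; ring.
by rewrite [C * _]mulrC -mulrA ler_wpM2l.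
Qed.

(** The averages at the radii $s_0+e$ and $s_0-e$ are compared. At the larger radius $T^n$ is
    negligible against $(s_0+e)^n$ for large [n], so $y$ is close to $-u$; uniformly in [n], $y$ is
    also close to $x$ relative to $u$. Hence $u+x=(s_0-e)^{-n}T^nx$ has norm at most that of $x$,
    and a single such power determines the growth rate. *)
Lemma spectral_growth_step (a b s0 : R) : 0 < a -> a < s0 < b ->
  (forall l, a <= rnorm (l : R[i]^o) <= b -> resolvent_set T l) ->
  (forall s, s0 < s -> growth T s) -> exists2 s, 0 < s < s0 & growth T s.
Proof.
move=> a0 /andP[as0 s0b] Tres Tgr.
have [C C0 TC] := resolvent_bound_annulus Tres.
pose L := b * C ^+ 2 + C.
have L0 : 0 < L by rewrite ltr_wpDl// mulr_ge0 ?exprn_ge0 ?(ltW C0)//; lra.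
(* Both radii must stay in the annulus, and their distance $2e$ times [L] must be at most $1/4$. *)
pose e := Num.min (Num.min (s0 - a) (b - s0)) (8 * L)^-1.
have e0 : 0 < e by rewrite !lt_min invr_gt0 mulr_gt0// !subr_gt0 as0 s0b.
have [ea eb eL] : [/\ e <= s0 - a, e <= b - s0 & e <= (8 * L)^-1].
  by rewrite /e !ge_min !lexx !orbT.
have {}eL : L * (2 * e) <= 4^-1.
  have := ler_wpM2l (ltW L0) eL; rewrite invfM mulrCA divff ?gt_eqF//; lra.
exists (s0 - e); first by lra.
have [K K0 TK] : growth T (s0 + e / 2) by apply: Tgr; lra.
have [N NP] := @pow_dominated _ K (s0 + e / 2) (s0 + e) ltac:(lra) ltac:(lra) 8^-1 ltac:(lra).
apply: (@growth_of_power _ _ T N.+1) => [//||x]; first by lra.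
have [y [Ty yx]] := @resolvent_average a b C (s0 + e) (s0 - e) N.+1 x isT Tres TC (ltW C0) a0
  ltac:(lra) ltac:(lra).
set u := _ - x in Ty yx.
have se0 : 0 < (s0 + e) ^+ N.+1 by rewrite exprn_gt0; lra.
have se0' : 0 < (s0 - e) ^+ N.+1 by rewrite exprn_gt0; lra.
have {}Ty : rnorm (u + y) <= 8^-1 * rnorm y.
  rewrite -(ler_pM2l se0) -[X in X * _ <= _](gtr0_norm se0) -rnorm_real -rnormZ.
  rewrite scalerDr -Ty subrK mulrA.
  by rewrite (le_trans (TK _ _))// ler_wpM2r ?rnorm_ge0// (le_trans (NP _ _))// mulrC.
have {}yx : rnorm (y - x) <= 4^-1 * rnorm u.
  rewrite (le_trans yx)// ler_wpM2r ?rnorm_ge0//.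
  have -> : `|s0 + e - (s0 - e)| = 2 * e by rewrite gtr0_norm; lra.
  exact: eL.
have ux : rnorm (u + x) <= rnorm (u + y) + rnorm (y - x).
  rewrite (_ : u + x = (u + y) - (y - x)) ?rnormB//.
  by rewrite opprB addrA [_ - _]addrAC addrK.
have yu : rnorm y <= rnorm (u + y) + rnorm u.
  by rewrite (_ : rnorm y = rnorm (u + y - u)) ?rnormB// addrC addKr.
have uxx : rnorm u <= rnorm (u + x) + rnorm x.
  by rewrite (_ : rnorm u = rnorm (u + x - x)) ?rnormB// addrK.
have : rnorm (u + x) <= rnorm x by have := rnorm_ge0 x; lra.
by rewrite subrK rnormZ rnormV rnorm_real gtr0_norm// ler_pdivrMl.
Qed.

(** If the infimum of the growth rates exceeded 1, the preceding lemma, applied to an annulus around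
    it lying outside the closed unit disc, would produce a smaller rate. *)
Lemma spectral_growth :
  (forall l, 1 < rnorm (l : R[i]^o) -> resolvent_set T l) -> subexponential T.
Proof.
move=> Tres r r1; apply/not_notP => Tr.
pose G := [set s | 0 < s /\ growth T s].
have [g g0 Tg] := growth_bound T.
have rG s : G s -> r <= s.
  move=> [s0 Ts]; rewrite leNgt; apply/negP => sr.
  by apply: Tr; exact: growth_le (ltW s0) (ltW sr) Ts.
have G0 : G !=set0 by exists g.
have lG : has_inf G by split=> //; exists r.
have rs0 : r <= inf G by apply: lb_le_inf.
have [|||s s0|s /andP[s0 sG] Ts] := @spectral_growth_step ((1 + r) / 2) (inf G + 1) (inf G).
- by lra.
- by lra.
- move=> l /andP[ll _]; apply: Tres; lra.
- have [t [t0 Tt] ts] := @inf_adherent _ G (s - inf G) ltac:(lra) lG.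
  apply: growth_le Tt; lra.
have : inf G <= s by apply: ge_inf => //; case: lG.
by lra.
Qed.

End spectral_radius.

(** * Clopen sets and continuous functions *)

Section clopen_sets.
Context {K : compactHausdorffType}.
Implicit Types (phi : homeomorphism K K) (D : set K) (k : K).

(** By regularity some neighbourhood has its closure inside [O]; the closure of its interior is open
    by extremal disconnectedness. *)
Lemma clopen_base : extremally_disconnected K ->
  forall k (O : set K), nbhs k O -> exists D, [/\ clopen D, D k & D `<=` O].
Proof.
move=> edK k O kO.
have [N kN NO] := @compact_regular K k setT hausdorffT compactT filterT O kO.
exists (closure N^°); split.
- split; last exact: closed_closure.
  by apply: edK; exact: open_interior.
- by apply: subset_closure; exact: kN.
- by apply: subset_trans NO; apply: closureS; exact: interior_subset.
Qed.

Lemma iter_continuous (f : K -> K) n : continuous f -> continuous (iter n f).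
Proof.
move=> cf; elim: n => [|n IH] k; first exact: cvg_id.
by apply: continuous_comp; [exact: IH|exact: cf].
Qed.

Lemma iter_phiK phi n : cancel (iter n phi) (iter n (homeo_inv phi)).
Proof. by elim: n => // n IH k; rewrite iterSr [X in homeo_inv phi X]iterS homeo_funK IH. Qed.

Lemma iter_phiVK phi n : cancel (iter n (homeo_inv phi)) (iter n phi).
Proof. by elim: n => // n IH k; rewrite iterSr [X in phi X]iterS homeo_invK IH. Qed.

Lemma iter_preim_clopen phi D n : clopen D -> clopen (iter n phi @^-1` D).
Proof.
move=> cD; apply: preimage_clopen => //; apply: iter_continuous.
exact: homeo_continuous.
Qed.

Lemma iter_preim_inv_clopen phi D n : clopen D -> clopen (iter n (homeo_inv phi) @^-1` D).
Proof.
move=> cD; apply: preimage_clopen => //; apply: iter_continuous.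
exact: homeo_inv_continuous.
Qed.

(** Induction on [n]: Hausdorff separation of [k] from its next iterate shrinks the neighbourhood
    until that iterate leaves it as well. *)
Lemma aperiodic_nbhs phi n k : (forall p, ~ periodic_point phi p) ->
  exists2 N, nbhs k N & forall j p, (0 < j <= n)%N -> N p -> ~ N (iter j phi p).
Proof.
move=> ap; elim: n => [|n [N kN Nn]].
  by exists setT => [|[|j] p]; first exact: filterT.
have kn : k != iter n.+1 phi k.
  by apply/eqP => kn; apply: (ap k); exists n.+1.
have := @hausdorffT K; rewrite open_hausdorff => /(_ _ _ kn).
move=> [[A B] /= [/set_mem Ak /set_mem Bk] [oA oB AB]].
exists (N `&` (A `&` iter n.+1 phi @^-1` B)) => [|j p].
  apply: filterI => //; apply: filterI; first exact: open_nbhs_nbhs.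
  apply: iter_continuous; first exact: homeo_continuous.
  exact: open_nbhs_nbhs.
move=> /andP[j0]; rewrite leq_eqVlt ltnS => /orP[/eqP->|jn] [Np [Ap Bp]] [Nq [Aq _]].
  by move/eqP: AB; apply/eqP/set0P; exists (iter n.+1 phi p).
by apply: (Nn j p) => //; rewrite j0.
Qed.

End clopen_sets.

Section CK_functions.
Context {R : realType} {K : compactHausdorffType}.
Implicit Types (f g : CK R K) (D E : set K) (k : K).

Lemma CK_rnorm_continuous f : continuous (fun k => rnorm (f k)).
Proof.
by move=> k; apply: continuous_comp; [exact: CK_continuous|exact: rnorm_continuous].
Qed.

Lemma char_fun_continuous D : clopen D -> continuous ((fun k => (k \in D)%:R) : K -> R[i]^o).
Proof.
move=> [oD cD] k; apply: cvg_near_cst.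
have [kD|kD] := pselect (D k).
  rewrite mem_set//; have := open_nbhs_nbhs (conj oD kD).
  by apply: filterS => q Dq; rewrite mem_set.
have oDC : open (~` D) by exact: closed_openC.
rewrite memNset//; have := open_nbhs_nbhs (conj oDC kD).
by apply: filterS => q Dq; rewrite memNset.
Qed.

(** The value [0] for a set that is not clopen is a default that makes the function total in [D]. *)
Definition char_fun D : CK R K :=
  if pselect (clopen D) is left cD then mkCK (char_fun_continuous cD) else 0.

Lemma char_funE D k : clopen D -> char_fun D k = (k \in D)%:R.
Proof. by move=> cD; rewrite /char_fun; case: pselect. Qed.

Lemma char_fun_in D k : clopen D -> D k -> char_fun D k = 1.
Proof. by move=> cD Dk; rewrite char_funE// mem_set. Qed.

Lemma char_fun_notin D k : clopen D -> ~ D k -> char_fun D k = 0.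
Proof. by move=> cD Dk; rewrite char_funE// memNset. Qed.

Lemma supnorm_char_fun D : supnorm (char_fun D) <= 1.
Proof.
apply: supnorm_le => // k; rewrite /char_fun; case: pselect => cD /=.
  change (rnorm ((k \in D)%:R : R[i]^o) <= 1).
  by case: (k \in D); rewrite ?rnorm1 ?rnorm0.
by change (rnorm (0 : R[i]^o) <= 1); rewrite rnorm0.
Qed.

Lemma CK_inv_continuous f : (forall k, f k != 0) ->
  continuous ((fun k => (f k)^-1) : K -> R[i]^o).
Proof. by move=> f0 k; apply: cvgV; [exact: f0|exact: CK_continuous]. Qed.

Lemma CK_partial_inverse D f : clopen D -> (forall k, D k -> f k != 0) ->
  exists g, (forall k, D k -> g k = (f k)^-1) /\ (forall k, ~ D k -> g k = 0).
Proof.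
move=> cD fD; pose h := char_fun D * f + (1 - char_fun D).
have hE k : h k = char_fun D k * f k + (1 - char_fun D k) by [].
have h0 k : h k != 0.
  rewrite hE; have [Dk|Dk] := pselect (D k).
    by rewrite char_fun_in// mul1r subrr addr0 fD.
  by rewrite char_fun_notin// mul0r add0r subr0 oner_eq0.
exists (char_fun D * mkCK (CK_inv_continuous h0)).
have gE k : (char_fun D * mkCK (CK_inv_continuous h0)) k = char_fun D k * (h k)^-1 by [].
split=> k Dk; rewrite gE.
  by rewrite hE char_fun_in// !mul1r subrr addr0.
by rewrite char_fun_notin// mul0r.
Qed.

Fixpoint cocycle (w : CK R K) (phi : homeomorphism K K) n : CK R K :=
  if n is m.+1 then w * comp_CK (cocycle w phi m) phi else 1.

Lemma cocycleS w phi n k : cocycle w phi n.+1 k = w k * cocycle w phi n (phi k).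
Proof. by []. Qed.

Lemma cocycleD w phi m n k :
  cocycle w phi (m + n) k = cocycle w phi m k * cocycle w phi n (iter m phi k).
Proof.
elim: m k => [|m IH] k; first by rewrite /= mul1r.
by rewrite addSn !cocycleS IH mulrA iterSr.
Qed.

Lemma cocycleSr w phi n k : cocycle w phi n.+1 k = cocycle w phi n k * w (iter n phi k).
Proof. by rewrite -addn1 cocycleD cocycleS [cocycle w phi 0 _]/(1 : R[i]) mulr1. Qed.

End CK_functions.

Arguments char_fun {R K} D.

(** * Neumann series *)

Lemma subr_chain (V : zmodType) (x y z : V) : (x - y) + (y - z) = x - z.
Proof. by rewrite addrA subrK. Qed.

Section geometric_sequences.
Context {R : realType}.

(** The form of completeness that Neumann series use. The constant 4 leaves room for adding the
    estimates of the real and imaginary parts. *)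
Definition geometrically_complete (V : normedModType R[i]) : Prop :=
  forall (C : R) (u : nat -> V), (forall n, rnorm (u n.+1 - u n) <= C / 2 ^+ n) ->
  exists l, forall n, rnorm (l - u n) <= 4 * C / 2 ^+ n.

Lemma half_pow_small (C e : R) : 0 < e -> exists N, forall n, (N <= n)%N -> C / 2 ^+ n < e.
Proof.
move=> e0; have [|||N NP] := @pow_dominated R C 2^-1 1 _ _ (e / 2); try lra.
exists N => n /NP; rewrite exprVn expr1n mulr1 => h.
by apply: le_lt_trans h _; lra.
Qed.

Lemma real_geometric_limit (C : R) (a : nat -> R) :
  (forall n, `|a n.+1 - a n| <= C / 2 ^+ n) -> exists l, forall n, `|l - a n| <= 2 * C / 2 ^+ n.
Proof.
(* [d n] is the tail of the geometric series, so the intervals $[a_n-d_n,a_n+d_n]$ are nested; the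
   limit is the supremum of their left ends. *)
move=> aC; pose d n := 2 * C / 2 ^+ n.
have dS n : d n = d n.+1 + C / 2 ^+ n.
  rewrite /d exprS invfM; set h := (2 ^+ n)^-1; lra.
have C0 : 0 <= C by have := le_trans (normr_ge0 _) (aC 0%N); rewrite expr0 divr1.
have d0 n : 0 <= d n by rewrite /d divr_ge0 ?mulr_ge0// exprn_ge0.
have lo n m : a n - d n <= a (n + m)%N - d (n + m)%N.
  elim: m => [|m IH]; first by rewrite addn0.
  rewrite addnS (le_trans IH)// (dS (n + m)%N).
  by have := aC (n + m)%N; rewrite ler_norml => /andP[h1 h2]; lra.
have up n m : a (n + m)%N + d (n + m)%N <= a n + d n.
  elim: m => [|m IH]; first by rewrite addn0.
  rewrite addnS (le_trans _ IH)// (dS (n + m)%N).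
  by have := aC (n + m)%N; rewrite ler_norml => /andP[h1 h2]; lra.
have loup n m : a m - d m <= a n + d n.
  have := lo m n; have := up n m; have := d0 (n + m)%N; rewrite (addnC m n); lra.
pose E := range (fun n => a n - d n).
have E0 : E !=set0 by exists (a 0%N - d 0%N); exists 0%N.
have Eub n : ubound E (a n + d n) by move=> _ [m _ <-].
exists (sup E) => n; rewrite ler_norml.
have h1 : sup E <= a n + d n by apply: ge_sup.
have h2 : a n - d n <= sup E.
  by apply: ub_le_sup; [exists (a 0%N + d 0%N)|exists n].
rewrite -/(d n); lra.
Qed.

Lemma complex_geometric_limit : geometrically_complete R[i]^o.
Proof.
move=> C u uC.
have ReC (z : R[i]) : `|complex.Re z| <= rnorm (z : R[i]^o).
  by rewrite /rnorm normc_def /= -sqrtr_sqr ler_wsqrtr// lerDl sqr_ge0.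
have ImC (z : R[i]) : `|complex.Im z| <= rnorm (z : R[i]^o).
  by rewrite /rnorm normc_def /= -sqrtr_sqr ler_wsqrtr// lerDr sqr_ge0.
have [|a aP] := @real_geometric_limit C (fun n => complex.Re (u n)).
  by move=> n; rewrite -raddfB (le_trans (ReC _)).
have [|b bP] := @real_geometric_limit C (fun n => complex.Im (u n)).
  by move=> n; rewrite -raddfB (le_trans (ImC _)).
exists (a +i* b) => n.
have -> : (a +i* b) - u n =
    (a - complex.Re (u n))%:C + 'i * (b - complex.Im (u n))%:C :> R[i].
  case: (u n) => x y.
  by apply/eqP; rewrite eq_complex /= !(mul0r, mul1r, mulr0, subr0, addr0, add0r) !eqxx.
rewrite (le_trans (rnormD _ _))// rnormM !rnorm_real.
have -> : rnorm ('i : R[i]^o) = 1 by rewrite /rnorm normCi.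
rewrite mul1r (_ : 4 * C / 2 ^+ n = 2 * C / 2 ^+ n + 2 * C / 2 ^+ n) ?lerD//.
by rewrite -mulrDl; congr (_ / _); lra.
Qed.

Lemma CK_geometrically_complete (K : compactHausdorffType) :
  geometrically_complete (CK R K).
Proof.
move=> C u uC.
have suC n : supnorm (u n.+1 - u n) <= C / 2 ^+ n by exact: uC.
have /choice[l lP] : forall k, exists l : R[i]^o, forall n, rnorm (l - u n k) <= 4 * C / 2 ^+ n.
  move=> k; apply: complex_geometric_limit => n; apply: le_trans (suC n).
  exact: (le_supnorm (u n.+1 - u n) k).
have cl : continuous l.
  move=> k; apply/cvgrPdist_lt => e e0.
  have [r er r0] : exists2 r : R, e = r%:C & 0 < r.
    exists (complex.Re e); last by rewrite -ltcR RRe_real// gtr0_real.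
    by rewrite RRe_real// gtr0_real.
  have [N NP] := @half_pow_small (4 * C) (r / 3) ltac:(lra).
  have rN : (0 : R[i]) < (r / 3)%:C by rewrite ltcR; lra.
  have /cvgrPdist_lt/(_ _ rN) := @CK_continuous _ _ (u N) k.
  apply: filterS => q; rewrite er -!ltr_rnorm => kq.
  have -> : l k - l q = (l k - u N k) + (u N k - u N q) - (l q - u N q).
    by rewrite opprB !subr_chain.
  have := NP N (leqnn N); have := lP k N; have := lP q N.
  have := rnormB (l k - u N k + (u N k - u N q)) (l q - u N q).
  have := rnormD (l k - u N k) (u N k - u N q); lra.
exists (mkCK cl) => n; rewrite /rnorm CK_normE /=; apply: supnorm_le => [|k].
  have := le_trans (supnorm_ge0 _) (suC n); rewrite -!mulrA => h.
  by rewrite mulr_ge0.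
exact: lP.
Qed.

Lemma Banach_geometrically_complete (V : completeNormedModType R[i]) :
  geometrically_complete V.
Proof.
move=> C u uC.
have C0 : 0 <= C by have := le_trans (rnorm_ge0 _) (uC 0%N); rewrite expr0 divr1.
have uD n m : rnorm (u (n + m)%N - u n) <= 2 * C / 2 ^+ n - 2 * C / 2 ^+ (n + m).
  elim: m => [|m IH]; first by rewrite addn0 !subrr rnorm0.
  have -> : u (n + m.+1)%N - u n = (u (n + m)%N.+1 - u (n + m)%N) + (u (n + m)%N - u n).
    by rewrite addnS addrA subrK.
  rewrite (le_trans (rnormD _ _))//; have := uC (n + m)%N; move: IH.
  by rewrite addnS exprS [(2 * _)^-1]invfM; set h := (2 ^+ (n + m))^-1; lra.
have uD2 n m : (n <= m)%N -> rnorm (u m - u n) <= 2 * C / 2 ^+ n.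
  move=> /subnKC <-; rewrite (le_trans (uD _ _))// lerBlDr lerDl.
  by rewrite divr_ge0 ?mulr_ge0// exprn_ge0.
have cu : cauchy (u @ \oo).
  apply/cauchy_exP => e e0.
  have [r er r0] : exists2 r : R, e = r%:C & 0 < r.
    exists (complex.Re e); last by rewrite -ltcR RRe_real// gtr0_real.
    by rewrite RRe_real// gtr0_real.
  have [N NP] := half_pow_small (2 * C) r0.
  exists (u N); exists N => // n /= Nn; rewrite -ball_normE /= er -ltr_rnorm.
  rewrite -rnormN opprB (le_lt_trans (uD2 _ _ Nn))//.
  exact: NP (leqnn N).
have /cvg_ex[l ul] : cvg (u @ \oo) by apply: cauchy_cvg.
exists l => n; apply/ler_addgt0Pr => e e0.
have e0' : (0 : R[i]) < e%:C by rewrite ltcR.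
have /cvgrPdist_lt/(_ _ e0')[N _ NP] := ul.
have := NP (maxn N n) (leq_maxl _ _); rewrite -ltr_rnorm => h.
have := uD2 n (maxn N n) (leq_maxr _ _).
have -> : l - u n = (l - u (maxn N n)) + (u (maxn N n) - u n) by rewrite addrA subrK.
have := rnormD (l - u (maxn N n)) (u (maxn N n) - u n).
have : 0 <= C / 2 ^+ n by rewrite divr_ge0// exprn_ge0.
rewrite -!mulrA; lra.
Qed.

End geometric_sequences.

Section Neumann.
Context {R : realType} {V : normedModType R[i]}.
Hypothesis cV : geometrically_complete V.

Lemma contraction_solve (A : 'L(V)) : (forall x, rnorm (A x) <= rnorm x / 2) ->
  forall x, exists y, y - A y = x.
Proof.
move=> Ah x; pose u n := \sum_(i < n) bpow A i x.
have Apow n : rnorm (bpow A n x) <= rnorm x / 2 ^+ n.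
  elim: n => [|n IH]; first by rewrite expr0 divr1.
  rewrite bpowS (le_trans (Ah _))// exprS invfM mulrCA mulrA.
  by move: IH; set h := (2 ^+ n)^-1; lra.
have uS n : u n.+1 = x + A (u n).
  by rewrite /u big_ord_recl linear_sum.
have [|l lP] := cV (C := rnorm x) (u := u).
  by move=> n; rewrite /u big_ord_recr /= [X in X - _]addrC addrK.
exists l; apply/eqP; rewrite -subr_eq0; apply/eqP/rnorm_eq0/eqP.
rewrite eq_le rnorm_ge0 andbT; apply/ler_addgt0Pr => e e0; rewrite add0r.
have [N NP] := @half_pow_small _ (8 * rnorm x) e e0.
have {NP} := NP N (leqnn _).
have -> : l - A l - x = (l - u N.+1) - A (l - u N).
  by rewrite uS linearB opprB opprD [RHS]addrA addrA subrK addrAC.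
have h1 := rnormB (l - u N.+1) (A (l - u N)).
have h2 := Ah (l - u N); have h3 := lP N; have := lP N.+1.
rewrite exprS [(2 * _)^-1]invfM; move: h3; set h := (2 ^+ N)^-1.
have := rnorm_ge0 x; lra.
Qed.

(** The finite sum $G=1+A+\dots+A^{N-1}$ satisfies $G(1-A)=(1-A)G=1-A^N$, which reduces both claims
    to the contraction $A^N$. *)
Lemma power_contraction_solve (A : 'L(V)) N : (forall x, rnorm (bpow A N x) <= rnorm x / 2) ->
  (forall x, exists y, y - A y = x) /\
  exists2 C : R, 0 < C & forall y, rnorm y <= C * rnorm (y - A y).
Proof.
move=> AN.
have gsum y : \sum_(i < N) bpow A i (y - A y) = y - bpow A N y.
  elim: N {AN} => [|n IH]; first by rewrite big_ord0 subrr.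
  by rewrite big_ord_recr IH linearB /= -bpowSr bpowS addrA subrK.
have gsum' y : (\sum_(i < N) bpow A i y) - A (\sum_(i < N) bpow A i y) = y - bpow A N y.
  by rewrite -gsum linear_sum -sumrB; apply: eq_bigr => i _; rewrite linearB -bpowSr bpowS.
split=> [x|].
  have [y yP] := contraction_solve AN x.
  by exists (\sum_(i < N) bpow A i y); rewrite gsum'.
pose G := (fun z => \sum_(i < N) bpow A i z).
have [C C0 GC] : exists2 C, 0 < C & forall z, rnorm (G z) <= C * rnorm z.
  rewrite /G; elim: N {AN gsum gsum' G} => [|n [C C0 GC]].
    by exists 1 => // z; rewrite big_ord0 rnorm0 mul1r rnorm_ge0.
  have [D D0 DP] := bop_bounded (bpow A n).
  exists (C + D) => [|z]; first exact: addr_gt0.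
  by rewrite big_ord_recr (le_trans (rnormD _ _))// mulrDl lerD.
exists (2 * C) => [|y]; first by rewrite mulr_gt0.
have := GC (y - A y); rewrite /G gsum => h.
have := rnorm_lerB y (bpow A N y); have := AN y; lra.
Qed.

End Neumann.

(** * Actions of C(K) *)

Record CK_action (R : realType) (K : compactHausdorffType) (V : normedModType R[i]) := CKAction {
  act :> CK R K -> 'L(V);
  actD : forall f g x, act (f + g) x = act f x + act g x;
  actM : forall f g x, act (f * g) x = act f (act g x);
  act1 : forall x, act 1 x = x;
  actZ : forall (c : R[i]) f x, act (c *: f) x = c *: act f x;
  act_contractive : forall f x, rnorm (act f x) <= supnorm f * rnorm x;
  act_faithful : forall f, (forall x, act f x = 0) -> f = 0
}.

Record covariant (R : realType) (K : compactHausdorffType) (V : normedModType R[i])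
    (a : CK_action K V) (phi : homeomorphism K K) (U Uinv : 'L(V)) : Prop := Covariant {
  cov_inverse : bop_inverse U Uinv;
  cov_act : forall f x, U (a f (Uinv x)) = a (comp_CK f phi) x;
  cov_subexp : subexponential U;
  cov_inv_subexp : subexponential Uinv
}.

Section action_lemmas.
Context {R : realType} {K : compactHausdorffType} {V : normedModType R[i]}.
Variables (a : CK_action K V) (phi : homeomorphism K K) (U Uinv : 'L(V)).
Hypothesis cov : covariant a phi U Uinv.
Variables (w : CK R K) (T : 'L(V)).
Hypothesis TE : forall x, T x = a w (U x).
Implicit Types (f g : CK R K) (D E : set K) (x y : V).

Let UK : cancel U Uinv := (cov_inverse cov).1.
Let UinvK : cancel Uinv U := (cov_inverse cov).2.

Lemma act0 x : a 0 x = 0.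
Proof. by have := actZ a 0 0 x; rewrite !scale0r. Qed.

Lemma actB f g x : a (f - g) x = a f x - a g x.
Proof. by rewrite actD -scaleN1r actZ scaleN1r. Qed.

Lemma act_le f (M : R) x : 0 <= M -> (forall k, rnorm (f k) <= M) -> rnorm (a f x) <= M * rnorm x.
Proof.
move=> M0 fM; rewrite (le_trans (act_contractive _ _ _))// ler_wpM2r ?rnorm_ge0//.
exact: supnorm_le.
Qed.

Lemma act_char_le D x : rnorm (a (char_fun D) x) <= rnorm x.
Proof.
rewrite (le_trans (act_contractive _ _ _))// -[X in _ <= X]mul1r.
by rewrite ler_wpM2r ?rnorm_ge0// supnorm_char_fun.
Qed.

Lemma U_act f x : U (a f x) = a (comp_CK f phi) (U x).
Proof. by rewrite -(cov_act cov) UK. Qed.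

Lemma bpow_UK n : cancel (bpow U n) (bpow Uinv n).
Proof. by elim: n => // n IH x; rewrite bpowSr bpowS UK IH. Qed.

(** The second estimate is the growth of the powers of [Uinv] applied to $U^nx$; one constant serves
    both directions. *)
Lemma U_two_sided (r : R) : 1 < r -> exists2 C, 1 <= C & forall n x,
  rnorm (bpow U n x) <= C * r ^+ n * rnorm x /\ rnorm x <= C * r ^+ n * rnorm (bpow U n x).
Proof.
move=> r1; have [C C0 UC] := cov_subexp cov r1; have [D D0 UD] := cov_inv_subexp cov r1.
exists (1 + C + D) => [|n x]; first by rewrite -addrA lerDl addr_ge0 ?ltW.
split; [apply: (le_trans (UC n x))|rewrite -{1}(bpow_UK n x); apply: (le_trans (UD n _))].
  rewrite ler_wpM2r ?rnorm_ge0// ler_wpM2r ?exprn_ge0//; lra.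
rewrite ler_wpM2r ?rnorm_ge0// ler_wpM2r ?exprn_ge0//; lra.
Qed.

Definition supported D x : Prop := a (char_fun D) x = x.

Lemma char_fun_mul D E : clopen D -> clopen E ->
  char_fun D * char_fun E = char_fun (D `&` E) :> CK R K.
Proof.
move=> cD cE; apply: CKP => k; have cDE := clopenI cD cE.
change (char_fun D k * char_fun E k = char_fun (D `&` E) k :> R[i]).
rewrite !char_funE// in_setI -natrM.
by case: (k \in D); case: (k \in E).
Qed.

Lemma supported_sub D E x : clopen D -> clopen E -> D `<=` E -> supported D x -> supported E x.
Proof.
move=> cD cE /setIidr DE Dx; rewrite /supported -Dx -actM char_fun_mul// DE.
by rewrite Dx.
Qed.

Lemma act_char_disjoint D E x : clopen D -> clopen E -> D `&` E = set0 -> supported D x ->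
  a (char_fun E) x = 0.
Proof.
move=> cD cE DE Dx; rewrite -Dx -actM char_fun_mul// setIC DE.
rewrite (_ : char_fun set0 = 0) ?act0//; apply: CKP => k.
by rewrite char_fun_notin//; exact: clopen0.
Qed.

Lemma supported_act D x : clopen D -> supported D (a (char_fun D) x).
Proof. by move=> cD; rewrite /supported -actM char_fun_mul// setIid. Qed.

(** Faithfulness: [char_fun D] is a nonzero function, so it does not act as zero. *)
Lemma supported_exists D k : clopen D -> D k -> exists2 x, x != 0 & supported D x.
Proof.
move=> cD Dk; have [x Dx] : exists x, a (char_fun D) x != 0.
  apply/not_existsP => Dx; have D0 : char_fun D = 0 :> CK R K.
    apply: (@act_faithful _ _ _ a) => x; apply/eqP; have := Dx x.
    by move/negP; rewrite negbK.
  have := char_fun_in (R := R) cD Dk; rewrite D0 => /eqP.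
  by rewrite eq_sym oner_eq0.
by exists (a (char_fun D) x) => //; exact: supported_act.
Qed.

Lemma U_char D x : clopen D -> U (a (char_fun D) x) = a (char_fun (phi @^-1` D)) (U x).
Proof.
move=> cD; rewrite U_act; congr (a _ _); apply: CKP => k.
change (char_fun D (phi k) = char_fun (phi @^-1` D) k :> R[i]).
by rewrite (char_funE _ cD) (char_funE _ (iter_preim_clopen phi 1 cD)).
Qed.

Lemma bpow_U_char D x n : clopen D ->
  bpow U n (a (char_fun D) x) = a (char_fun (iter n phi @^-1` D)) (bpow U n x).
Proof.
move=> cD; elim: n => //= n IH; rewrite IH U_char; last exact: iter_preim_clopen.
by congr (a (char_fun _) _); apply/seteqP; split=> k /=; rewrite -iterSr.
Qed.

Lemma bpow_T n x : bpow T n x = a (cocycle w phi n) (bpow U n x).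
Proof.
elim: n => [|n IH]; first by rewrite act1.
by rewrite bpowS IH TE U_act -actM.
Qed.

Lemma T_char D x n : clopen D ->
  bpow T n (a (char_fun D) x) = a (char_fun (iter n phi @^-1` D)) (bpow T n x).
Proof. by move=> cD; rewrite !bpow_T bpow_U_char// -!actM mulrC. Qed.

Lemma supported_T D x n : clopen D -> supported D x ->
  supported (iter n phi @^-1` D) (bpow T n x).
Proof. by move=> cD Dx; rewrite /supported -T_char// Dx. Qed.

(** $T^nx=w_nU^nx$ and $U^nx$ is supported in $\varphi^{-n}(D)$, so only the values of $w_n$ on that
    set count. *)
Lemma bpow_T_le D x n (M : R) : clopen D -> supported D x -> 0 <= M ->
  (forall k, D (iter n phi k) -> rnorm (cocycle w phi n k) <= M) ->
  rnorm (bpow T n x) <= M * rnorm (bpow U n x).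
Proof.
move=> cD Dx M0 wM; have cDn := iter_preim_clopen phi n cD.
rewrite bpow_T -{1}Dx bpow_U_char// -actM; apply: act_le => // k.
change (rnorm (cocycle w phi n k * char_fun (iter n phi @^-1` D) k : R[i]^o) <= M).
rewrite char_funE//; have [Dk|Dk] := pselect (D (iter n phi k)).
  by rewrite mem_set// mulr1 wM.
by rewrite memNset// mulr0 rnorm0.
Qed.

(** The reverse estimate: on $\varphi^{-n}(D)$ the cocycle has no zero, and acting by its partial
    inverse recovers $U^nx$ from $T^nx$. *)
Lemma le_bpow_T D x n (M : R) : clopen D -> supported D x -> 0 <= M ->
  (forall k, D (iter n phi k) -> 1 <= M * rnorm (cocycle w phi n k)) ->
  rnorm (bpow U n x) <= M * rnorm (bpow T n x).
Proof.
move=> cD Dx M0 wM; have cDn := iter_preim_clopen phi n cD.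
have w0 k : D (iter n phi k) -> cocycle w phi n k != 0.
  by move=> /wM; apply: contraTneq => ->; rewrite rnorm0 mulr0 ler10.
have [g [gD gN]] := CK_partial_inverse cDn w0.
have -> : bpow U n x = a g (bpow T n x).
  rewrite bpow_T -actM -{1}Dx bpow_U_char//; congr (a _ _); apply: CKP => k.
  change (char_fun (iter n phi @^-1` D) k = g k * cocycle w phi n k :> R[i]).
  have [Dk|Dk] := pselect (D (iter n phi k)).
    by rewrite char_fun_in// gD// mulVf// w0.
  by rewrite char_fun_notin// gN// mul0r.
apply: act_le => // k; have [Dk|Dk] := pselect (D (iter n phi k)); last first.
  by rewrite gN// rnorm0.
rewrite gD// rnormV -[X in X <= _]mul1r ler_pdivrMr ?wM//.
by rewrite rnorm_gt0 w0.
Qed.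

End action_lemmas.

(** * The dichotomy implies invertibility *)

Definition hyperbolic (R : realType) (K : compactHausdorffType) (w : CK R K)
    (phi : homeomorphism K K) : Prop :=
  exists E : set K, [/\ clopen E, forall k, E (phi k) <-> E k &
    exists B rho N, [/\ 0 < B, 0 < rho < 1 & forall n k, (N <= n)%N ->
      (E k -> rnorm (cocycle w phi n k) <= B * rho ^+ n) /\
      (~ E k -> 1 <= B * rho ^+ n * rnorm (cocycle w phi n k))]].

Section sufficiency.
Context {R : realType} {K : compactHausdorffType} {V : normedModType R[i]}.
Variables (a : CK_action K V) (phi : homeomorphism K K) (U Uinv : 'L(V)).
Hypothesis cov : covariant a phi U Uinv.
Variables (w : CK R K) (T : 'L(V)).
Hypothesis TE : forall x, T x = a w (U x).

Let UK : cancel U Uinv := (cov_inverse cov).1.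
Let UinvK : cancel Uinv U := (cov_inverse cov).2.

Lemma iter_invariant (E : set K) : (forall k, E (phi k) <-> E k) ->
  forall n k, E (iter n phi k) <-> E k.
Proof. by move=> Ephi; elim=> // n IH k; rewrite iterS Ephi IH. Qed.

Lemma char_funC (D : set K) : clopen D -> char_fun (~` D) = 1 - char_fun D :> CK R K.
Proof.
move=> cD; apply: CKP => k.
change (char_fun (~` D) k = 1 - char_fun D k :> R[i]).
have cDC := clopenC D cD; have [Dk|Dk] := pselect (D k).
  by rewrite char_fun_notin// char_fun_in// subrr.
by rewrite char_fun_in// char_fun_notin// subr0.
Qed.

(** The characteristic functions of [E] and its complement give projections [P] and [Q] commuting
    with [T]. High powers of [T] contract on the range of [P]; on the range of [Q] the operator [T]
    has an inverse [T'] whose high powers contract. Neumann series for [T P] and for [T'] then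
    invert $T-1$ on the two parts. *)
Lemma resolvent1_hyperbolic : geometrically_complete V -> hyperbolic w phi ->
  resolvent_set T 1.
Proof.
move=> cV [E [cE Ephi [B [rho [N [B0 /andP[rho0 rho1] wE]]]]]].
have cF := clopenC E cE.
have Fphi k : (~` E) (phi k) <-> (~` E) k by split=> nE Ek; apply: nE; apply/Ephi.
(* Any [eta] with $1<\eta<1/\rho$ would do; then $\rho\eta<1$ absorbs the subexponential growth of
   the powers of [U]. *)
have eta1 : 1 < (1 + rho^-1) / 2.
  by have : 1 < rho^-1 by [rewrite invf_gt1|]; lra.
set eta := (X in 1 < X) in eta1.
have rhoeta0 : 0 < rho * eta by rewrite mulr_gt0//; lra.
have rhoeta1 : rho * eta < 1.
  by rewrite /eta mulrA mulrDr divff ?gt_eqF//; lra.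
have [C C1 UC] := U_two_sided cov eta1.
have [M MP] := @pow_dominated R (B * C) _ 1 rhoeta0 rhoeta1 2^-1 ltac:(lra).
(* The exponent [n.+1] is positive, as needed for $(TP)^{n+1}=T^{n+1}P$ and for reading off
   [w k != 0] from the cocycle. *)
pose n := (M + N)%N.
have Nn : (N <= n.+1)%N by rewrite /n leqW// leq_addl.
have small : B * rho ^+ n.+1 * (C * eta ^+ n.+1) <= 2^-1.
  have : (M <= n.+1)%N by rewrite /n leqW// leq_addr.
  by move=> /MP; rewrite expr1n mulr1 exprMn; apply: le_trans; rewrite mulrACA.
have Brho0 : 0 <= B * rho ^+ n.+1 by rewrite mulr_ge0 ?exprn_ge0// ltW.
have Ceta0 : 0 <= C * eta ^+ n.+1 by rewrite mulr_ge0 ?exprn_ge0//; lra.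
pose P := a (char_fun E); pose Q := a (char_fun (~` E)).
have QE x : Q x = x - P x by rewrite /Q char_funC// actB act1.
have PP x : P (P x) = P x by exact: supported_act.
have preimE D : (forall k, D (phi k) <-> D k) -> phi @^-1` D = D :> set K.
  by move=> Dphi; apply/seteqP; split=> k /Dphi.
have PT x : P (T x) = T (P x).
  have := T_char cov TE x 1 cE.
  by rewrite (_ : iter 1 phi @^-1` E = E) ?preimE//= => ->.
have PTn m x : P (bpow T m x) = bpow T m (P x).
  by elim: m => // m IH; rewrite !bpowS PT IH.
have UQ x : U (Q x) = Q (U x) by rewrite /Q (U_char cov)// preimE.
have [A_solve [C1' C1'0 A_bound]] : (forall x, exists y, y - comp_bop T P y = x) /\
  exists2 C : R, 0 < C & forall y, rnorm y <= C * rnorm (y - comp_bop T P y).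
  apply: (@power_contraction_solve _ _ cV _ n.+1) => x.
  have -> : bpow (comp_bop T P) n.+1 x = bpow T n.+1 (P x).
    elim: (n) => // m IH; rewrite bpowS IH.
    change (T (P (bpow T m.+1 (P x))) = T (bpow T m.+1 (P x))).
    by rewrite PTn PP.
  have Ps : supported a E (P x) by exact: PP.
  apply: (le_trans (bpow_T_le cov TE cE Ps Brho0 _)) => [k|].
    by move=> /(iter_invariant Ephi); exact: (wE _ _ Nn).1.
  apply: (@le_trans _ _ (B * rho ^+ n.+1 * (C * eta ^+ n.+1 * rnorm x))).
    rewrite ler_wpM2l// (le_trans (UC _ _).1)// ler_wpM2l//.
    exact: act_char_le.
  by rewrite mulrA [rnorm x / 2]mulrC ler_wpM2r ?rnorm_ge0.
have w0 k : (~` E) k -> w k != 0.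
  move=> /(wE _ _ Nn).2; apply: contraTneq => wk0.
  by rewrite cocycleS wk0 mul0r rnorm0 mulr0 ler10.
have [v [vF vE]] := CK_partial_inverse cF w0.
have wv : w * v = char_fun (~` E).
  apply: CKP => k; change (w k * v k = char_fun (~` E) k :> R[i]).
  have [Ek|Ek] := pselect ((~` E) k).
    by rewrite vF// char_fun_in// divff// w0.
  by rewrite vE// char_fun_notin// mulr0.
pose T' := comp_bop Uinv (a v).
have TT' x : T (T' x) = Q x by rewrite TE /= UinvK -actM wv.
have T'T x : T' (T x) = Q x by rewrite /= TE -actM mulrC wv -/Q -UQ UK.
have T'Q x : T' (Q x) = T' x.
  rewrite /= -actM; congr (Uinv (a _ _)); apply: CKP => k.
  change (v k * char_fun (~` E) k = v k :> R[i]).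
  have [Ek|Ek] := pselect ((~` E) k); first by rewrite char_fun_in// mulr1.
  by rewrite vE// mul0r.
have QT' x : Q (T' x) = T' x by rewrite -T'T TT' T'Q.
have T'pow m x : bpow T m.+1 (bpow T' m.+1 x) = Q x.
  elim: m => [|m IH]; first by rewrite /= -/(T' x) TT'.
  by rewrite bpowSr [bpow T' m.+2 x]bpowS TT' [bpow T' m.+1 x]bpowS QT' -bpowS.
have [T'_solve [C2 C20 T'_bound]] : (forall x, exists y, y - T' y = x) /\
  exists2 C : R, 0 < C & forall y, rnorm y <= C * rnorm (y - T' y).
  apply: (@power_contraction_solve _ _ cV _ n.+1) => x.
  have Qs : supported a (~` E) (bpow T' n.+1 x) by rewrite /supported bpowS -/Q QT'.
  apply: (le_trans (UC n.+1 _).2).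
  have h k : (~` E) (iter n.+1 phi k) ->
      1 <= B * rho ^+ n.+1 * rnorm (cocycle w phi n.+1 k).
    by move=> /(iter_invariant Fphi); exact: (wE _ _ Nn).2.
  apply: (le_trans (ler_wpM2l Ceta0 (le_bpow_T cov TE cF Qs Brho0 h))).
  rewrite T'pow mulrA [C * _ * _]mulrC [rnorm x / 2]mulrC.
  by rewrite ler_pM ?rnorm_ge0 ?act_char_le// mulr_ge0.
apply/resolvent_setP; split.
  have [D D0 T'D] := bop_bounded T'.
  exists (C1' + C2 * D) => [|x]; first by rewrite addr_gt0// mulr_gt0.
  rewrite scale1r -{1}(subrK (P x) x) -QE (le_trans (rnormD _ _))// addrC mulrDl lerD//.
    rewrite (le_trans (A_bound _))// ler_pM2l//= PP -PT -linearB.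
    by rewrite -rnormN -linearN opprB act_char_le.
  rewrite (le_trans (T'_bound _))// -mulrA ler_pM2l// T'Q -T'T -linearB /=.
  by rewrite (le_trans (T'D _)).
move=> y; have [y1 y1P] := A_solve (- y); have [z zP] := T'_solve (- y).
(* $T-1$ maps $Py_1$ to $Py$, and it maps $-T'z$ to $T'z-Qz=Qy$. *)
exists (P y1 - T' z); rewrite scale1r linearB TT'.
have e1 : T (P y1) - P y1 = P y.
  by rewrite -[y in RHS]opprK -y1P linearN linearB /= -/P PT PP opprB.
have e2 : T' z - Q z = Q y.
  by rewrite -[y in RHS]opprK -zP linearN linearB QT' opprB.
by rewrite opprB [T' z - _]addrC addrACA [- Q z + _]addrC e1 e2 QE addrC subrK.
Qed.

End sufficiency.

(** * Invertibility implies the dichotomy *)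

Section necessity.
Context {R : realType} {K : compactHausdorffType} {V : normedModType R[i]}.
Variables (a : CK_action K V) (phi : homeomorphism K K) (U Uinv : 'L(V)).
Hypothesis cov : covariant a phi U Uinv.
Variables (w : CK R K) (T : 'L(V)).
Hypothesis TE : forall x, T x = a w (U x).
Hypothesis edK : extremally_disconnected K.

Let UK : cancel U Uinv := (cov_inverse cov).1.
Let UinvK : cancel Uinv U := (cov_inverse cov).2.

(** At a zero of [w], vectors [z] supported in small clopen neighbourhoods make $TU^{-1}z=wz$
    arbitrarily small relative to $z$, against the lower bound for [T]. *)
Lemma resolvent0P : resolvent_set T 0 <-> forall k, w k != 0.
Proof.
split=> [/resolvent_setP[[C C0 TC] _] k|w0]; last first.
  have [v [vT _]] := CK_partial_inverse (@clopenT K) (fun k _ => w0 k).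
  have wv : w * v = 1.
    by apply: CKP => k; change (w k * v k = 1 :> R[i]); rewrite vT// divff.
  exists (comp_bop Uinv (a v)); split=> x; rewrite scale0r subr0.
    by rewrite /= TE -actM mulrC wv act1 UK.
  by rewrite TE /= UinvK -actM wv act1.
apply/negP => /eqP wk0.
have [D D0 UD] := bop_bounded U.
have CD0 : 0 < C * D by rewrite mulr_gt0.
pose e := (2 * (C * D))^-1.
have e0 : 0 < e by rewrite invr_gt0 mulr_gt0.
have : \forall q \near k, rnorm (w q) < e.
  have /cvgr_lt := @CK_rnorm_continuous _ _ w k; apply.
  by rewrite wk0 rnorm0.
move=> /(clopen_base edK)[E [cE Ek Ee]].
have [z z0 Ez] := supported_exists a cE Ek.
have : rnorm (T (Uinv z)) <= e * rnorm z.
  rewrite TE UinvK -{1}Ez -actM; apply: act_le => [|q]; first exact: ltW.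
  change (rnorm (w q * char_fun E q : R[i]^o) <= e).
  have [Eq|Eq] := pselect (E q); first by rewrite char_fun_in// mulr1 ltW// Ee.
  by rewrite char_fun_notin// mulr0 rnorm0 ltW.
have := TC (Uinv z); rewrite scale0r subr0 => h1 h2.
have := UD (Uinv z); rewrite UinvK => h3.
have := rnorm_gt0 z; rewrite z0 => zgt0.
have : rnorm z <= D * (C * (e * rnorm z)).
  by rewrite (le_trans h3)// ler_pM2l// (le_trans h1)// ler_pM2l.
have -> : D * (C * (e * rnorm z)) = rnorm z / 2.
  rewrite !mulrA [D * C]mulrC /e invfM mulrCA divff ?gt_eqF//; lra.
by lra.
Qed.

Lemma clopen_tower (D : set K) m : clopen D ->
  clopen [set k | exists2 j, (j <= m)%N & D (iter j phi k)].
Proof.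
move=> cD; elim: m => [|m IH].
  rewrite (_ : [set _ | _] = D)//; apply/seteqP; split=> k.
    by move=> [j]; rewrite leqn0 => /eqP ->.
  by move=> Dk; exists 0%N.
rewrite (_ : [set _ | _] = [set k | exists2 j, (j <= m)%N & D (iter j phi k)] `|`
    (iter m.+1 phi @^-1` D)).
  by apply: clopenU => //; exact: iter_preim_clopen.
apply/seteqP; split=> k.
  by move=> [j]; rewrite leq_eqVlt ltnS => /orP[/eqP->|jm] Dj; [right|left; exists j].
by case=> [[j jm Dj]|Dm]; [exists j => //; exact: leqW|exists m.+1].
Qed.

(** A common point of two levels would yield a point of [D] returning to [D] within [N] steps. *)
Lemma tower_disjoint (D : set K) N i j :
  (forall j k, (0 < j <= N)%N -> D k -> ~ D (iter j phi k)) ->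
  (i <= N)%N -> (j <= N)%N -> i != j ->
  (iter i phi @^-1` D) `&` (iter j phi @^-1` D) = set0.
Proof.
move=> DN; wlog ij : i j / (i < j)%N.
  move=> H iN jN; rewrite neq_ltn => /orP[ij|ji]; first by apply: H => //; rewrite ltn_eqF.
  by rewrite setIC; apply: H => //; rewrite ltn_eqF.
move=> iN jN _; apply/seteqP; split=> k // -[/= Di].
rewrite -(subnK (ltnW ij)) iterD; apply: DN => //.
by rewrite subn_gt0 ij (leq_trans (leq_subr _ _)).
Qed.

(* The weights [r ^ |j - m|] on [T^j x] make [T y - y] small compared with [y], up to the two
   ends of the tower, since the pieces [y1] and [y2] on the two sides of level [m] have
   disjoint supports. *)
Lemma tower_inequality (c r : R) m n (D : set K) x :
  (forall y, c * rnorm y <= rnorm (T y - y)) -> 0 < r < 1 -> 0 <= c -> r^-1 - r <= c / 2 ->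
  clopen D -> supported a D x -> (forall j k, (0 < j <= m + n)%N -> D k -> ~ D (iter j phi k)) ->
  c / 2 * rnorm (bpow T m x) <= r ^+ m.+1 * rnorm x + r ^+ n * rnorm (bpow T (m + n).+1 x).
Proof.
move=> Tc /andP[r0 r1] c0 rc cD Dx DN.
have disj i j : (i <= m + n)%N -> (j <= m + n)%N -> i != j ->
    a (char_fun (iter i phi @^-1` D)) (bpow T j x) = 0.
  move=> iN jN ij; apply: (act_char_disjoint (D := iter j phi @^-1` D)).
  - exact: iter_preim_clopen.
  - exact: iter_preim_clopen.
  - by rewrite setIC; exact: (tower_disjoint DN).
  - exact: (supported_T cov TE).
have cE := clopen_tower m cD; set E := [set k | _] in cE.
have r1' : r^-1 != 0 by rewrite invr_eq0 gt_eqF.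
(* In terms of the weights, $y_1=\sum_{j\le m}r^{m-j}T^jx$ and $y_2=\sum_{m<j\le m+n}r^{j-m}T^jx$.
   Written with [pgeom], each telescopes under [T]. *)
pose v := bpow T m.+1 x.
pose y1 := pgeom T r%:C m.+1 x.
pose y2 := (r ^+ n)%:C *: pgeom T (r^-1)%:C n v.
pose y := y1 + y2.
have Tv j : bpow T j v = bpow T (j + m.+1) x by rewrite bpowD.
have Ty1 : T y1 = r%:C *: y1 + (v - (r ^+ m.+1)%:C *: x).
  by rewrite rmorphXn -(pgeom_root T) addrC subrK.
have Ty2 : T y2 = (r^-1)%:C *: y2 + ((r ^+ n)%:C *: bpow T (m + n).+1 x - v).
  rewrite {1}/y2 linearZ /= -[T (pgeom _ _ _ _)](subrK ((r^-1)%:C *: pgeom T (r^-1)%:C n v)).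
  rewrite pgeom_root scalerDr scalerBr Tv addnS [(n + m)%N]addnC addrC.
  have rn : (r ^+ n)%:C * (r^-1)%:C ^+ n = 1 :> R[i].
    by rewrite -rmorphXn -rmorphM exprVn divff// expf_neq0// gt_eqF.
  by rewrite !scalerA rn scale1r mulrC.
have Ey1 : a (char_fun E) y1 = y1.
  rewrite /y1 /pgeom linear_sum; apply: eq_bigr => j _; rewrite linearZ; congr (_ *: _).
  apply: (@supported_sub _ _ _ a (iter j phi @^-1` D)) => //.
  - exact: iter_preim_clopen.
  - by move=> k Dk; exists j => //; rewrite -ltnS.
  - exact: (supported_T cov TE).
have Ey2 : a (char_fun E) y2 = 0.
  rewrite /y2 linearZ /pgeom linear_sum big1 => [|j _]; first exact: scaler0.
  rewrite linearZ Tv /=.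
  rewrite (act_char_disjoint (D := iter (j + m.+1) phi @^-1` D)) ?scaler0//.
  - exact: iter_preim_clopen.
  - apply/seteqP; split=> k // -[/= Djm [i im Di]].
    have : (iter i phi @^-1` D `&` iter (j + m.+1) phi @^-1` D) k by [].
    rewrite (tower_disjoint DN)//.
    + by rewrite (leq_trans im) ?leq_addr.
    + by rewrite addnS -addSn addnC leq_add2l.
    + by rewrite ltn_eqF// (leq_ltn_trans im)// addnS ltnS leq_addl.
  - exact: (supported_T cov TE).
have y1y : rnorm y1 <= rnorm y.
  by rewrite -Ey1 -[a _ y1]addr0 -Ey2 -linearD act_char_le.
have y2y : rnorm y2 <= rnorm y.
  have -> : y2 = a (char_fun (~` E)) y.
    by rewrite char_funC// actB act1 linearD Ey1 Ey2 addr0 /y addrC addKr.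
  exact: act_char_le.
have ymy : rnorm (bpow T m x) <= rnorm y.
  have -> : bpow T m x = a (char_fun (iter m phi @^-1` D)) y.
    rewrite linearD /y1 /y2 linearZ /pgeom big_ord_recr linearD !linear_sum /=.
    rewrite subnn expr0 scale1r [X in _ = X + _ + _]big1 => [|j _] /=; last first.
      rewrite linearZ /=.
      have -> : a (char_fun (iter m phi @^-1` D)) (bpow T j x) = 0.
        have jm := ltn_ord j.
        by apply: disj; rewrite ?leq_addr ?(leq_trans (ltnW jm)) ?leq_addr ?gtn_eqF.
      exact: scaler0.
    rewrite add0r big1 => [|j _].
      by rewrite scaler0 addr0 (supported_T cov TE).
    rewrite linearZ Tv /=.
    have -> : a (char_fun (iter m phi @^-1` D)) (bpow T (j + m.+1) x) = 0.
      apply: disj; first exact: leq_addr.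
        by rewrite addnS -addSn addnC leq_add2l.
      by rewrite ltn_eqF// addnS ltnS leq_addl.
    exact: scaler0.
  exact: act_char_le.
(* The two terms [v] cancel. The remaining factors have absolute values $1-r$ and $r^{-1}-1$; their
   sum $r^{-1}-r$ is at most $c/2$ and is absorbed by the lower bound. *)
have TyE : T y - y = ((r - 1)%:C *: y1 + (r^-1 - 1)%:C *: y2) +
    ((r ^+ n)%:C *: bpow T (m + n).+1 x - (r ^+ m.+1)%:C *: x).
  rewrite /y linearD Ty1 Ty2 !rmorphB !scalerBl !rmorph1 !scale1r.
  rewrite addrACA [v - _ + _]addrC subr_chain [LHS]addrAC; congr (_ + _).
  by rewrite opprD addrACA.
clearbody y1 y2; have := Tc y; rewrite TyE => /le_trans/(_ (rnormD _ _)).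
move: (rnormD ((r - 1)%:C *: y1) ((r^-1 - 1)%:C *: y2)).
move: (rnormB ((r ^+ n)%:C *: bpow T (m + n).+1 x) ((r ^+ m.+1)%:C *: x)).
have rV1 : 1 < r^-1 by rewrite invf_gt1.
have r10 : `|r - 1| = 1 - r by rewrite ltr0_norm ?opprB// subr_lt0.
have rV0 : `|r^-1 - 1| = r^-1 - 1 by rewrite gtr0_norm// subr_gt0.
rewrite !rnormZ !rnorm_real r10 rV0 !(ger0_norm (exprn_ge0 _ (ltW r0))).
have b1 : (1 - r) * rnorm y1 <= (1 - r) * rnorm y by rewrite ler_wpM2l// subr_ge0 ltW.
have b2 : (r^-1 - 1) * rnorm y2 <= (r^-1 - 1) * rnorm y by rewrite ler_wpM2l// subr_ge0 ltW.
have b3 : (r^-1 - r) * rnorm y <= c / 2 * rnorm y by rewrite ler_wpM2r// rnorm_ge0.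
have b4 : c / 2 * rnorm (bpow T m x) <= c / 2 * rnorm y by rewrite ler_wpM2l// divr_ge0.
move=> h1 h2 h3.
by lra.
Qed.

End necessity.

(** * Decay and growth of the cocycle along orbits *)

Section dichotomy.
Context {R : realType} {K : compactHausdorffType} {V : normedModType R[i]}.
Variables (a : CK_action K V) (phi : homeomorphism K K) (U Uinv : 'L(V)).
Hypothesis cov : covariant a phi U Uinv.
Variables (w : CK R K) (T : 'L(V)).
Hypothesis TE : forall x, T x = a w (U x).
Hypothesis edK : extremally_disconnected K.
Hypothesis aper : forall k, ~ periodic_point phi k.

Let psi := homeo_inv phi.

Lemma iter_phi_psi n j k : iter n psi (iter j phi k) = iter j phi (iter n psi k).
Proof.
by rewrite -{1}(iter_phiVK phi n k) -iterD addnC iterD iter_phiK.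
Qed.

(** For a small clopen neighbourhood $D_0$ of [k] the base is $D=\varphi^{n+m}(D_0)$, so that level
    [m] of the tower is $\varphi^n(D_0)$, whose points are carried by $\varphi^{-n}$ into $D_0$. *)
Lemma small_tower m n N (k : K) (P : K -> Prop) : (\forall q \near k, P q) ->
  exists D x, [/\ clopen D, supported a D x, x != 0,
    forall j q, (0 < j <= N)%N -> D q -> ~ D (iter j phi q) &
    forall q, D (iter m phi q) -> P (iter n psi q)].
Proof.
move=> kP; have [G kG GN] := aperiodic_nbhs N k aper.
have [D0 [cD0 D0k D0P]] := clopen_base edK (filterI kP kG).
have cD := iter_preim_inv_clopen phi (n + m) cD0.
have Dk : (iter (n + m) psi @^-1` D0) (iter (n + m) phi k) by rewrite /= iter_phiK.
have [x x0 Dx] := supported_exists a cD Dk.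
exists (iter (n + m) psi @^-1` D0), x; split=> //.
  move=> j q jN /= /D0P[_ Oq]; rewrite -/psi iter_phi_psi => /D0P[_ Oq'].
  exact: GN jN Oq Oq'.
by move=> q; rewrite /= -/psi iterD iter_phiK => /D0P[].
Qed.

Lemma iter_rnorm_continuous (f : CK R K) n : continuous (fun k => rnorm (f (iter n phi k))).
Proof.
move=> k; apply: (@continuous_comp _ _ _ (iter n phi) (fun q => rnorm (f q))).
  by apply: iter_continuous; exact: homeo_continuous.
exact: CK_rnorm_continuous.
Qed.

Lemma near_rnorm_lt (f : CK R K) n (k : K) r : rnorm (f (iter n phi k)) < r ->
  \forall q \near k, rnorm (f (iter n phi q)) < r.
Proof. by move=> fr; have /cvgr_lt := @iter_rnorm_continuous f n k; apply. Qed.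

Lemma near_rnorm_gt (f : CK R K) n (k : K) r : r < rnorm (f (iter n phi k)) ->
  \forall q \near k, r < rnorm (f (iter n phi q)).
Proof. by move=> fr; have /cvgr_gt := @iter_rnorm_continuous f n k; apply. Qed.

(** If both alternatives failed at [q], they would fail near it. On a tower with level [m] near [q],
    the vectors $x$ and $T^{2m+1}x$ would then be too small compared with $T^mx$ for the tower
    inequality. *)
Lemma decay_or_growth : resolvent_set T 1 -> exists rho eta B,
  [/\ 0 < rho < 1, 1 < eta, rho * eta < 1, 0 < B &
  forall m q, B * rho ^+ m < rnorm (cocycle w phi m q) ->
    1 <= B * rho ^+ m.+1 * rnorm (cocycle w phi m.+1 (iter m.+1 psi q))].
Proof.
move=> /resolvent_setP[[c' c'0 Tc'] _].
have [c c0 Tc] : exists2 c, 0 < c & forall y, c * rnorm y <= rnorm (T y - y).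
  exists c'^-1 => [|y]; first by rewrite invr_gt0.
  by have := Tc' y; rewrite scale1r ler_pdivrMl.
(* With $r=1/(1+d)$ one has $r^{-1}-r\le 2d\le c/2$. Since $\eta^2<1+d$, the rate $\rho=r\eta$
   satisfies $\rho\eta<1$. *)
pose d := Num.min 1 (c / 4).
have d0 : 0 < d by rewrite lt_min ltr01 divr_gt0.
have [d1 dc] : d <= 1 /\ d <= c / 4 by rewrite !ge_min !lexx orbT.
pose r := (1 + d)^-1.
have r0 : 0 < r by rewrite invr_gt0; lra.
have rd : r * (1 + d) = 1 by rewrite mulVf// gt_eqF//; lra.
have r1 : r < 1 by rewrite -rd ltr_pMr//; lra.
have rVr : r^-1 - r <= c / 2.
  by rewrite /r invrK -/r; nra.
pose eta := 1 + d / 4.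
pose rho := r * eta.
have eta1 : 1 < eta by rewrite /eta; lra.
have rho0 : 0 < rho by rewrite mulr_gt0//; lra.
have reta : rho * eta < 1.
  have : eta * eta < 1 + d by rewrite /eta; nra.
  by rewrite -(ltr_pM2l r0) rd mulrA.
have [C C1 UC] := U_two_sided cov eta1.
(* Chosen so that $C(r+r^{-1})/B<c/2$. The powers of [r] and [eta] cancel against those of [rho],
   hence [B] does not depend on [m]. *)
pose B := 2 * C * (r + r^-1) / c + 1.
have rV0 : 0 < r^-1 by rewrite invr_gt0.
have B0 : 0 < B.
  by rewrite ltr_wpDl// divr_ge0 ?(ltW c0)// !mulr_ge0//; lra.
exists rho, eta, B; split=> //.
  by rewrite rho0 /=; apply: lt_trans reta; rewrite ltr_pMr.
move=> m q wm; rewrite leNgt; apply/negP => wm1.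
set k := iter m.+1 psi q in wm1.
have Bm n : 0 < B * rho ^+ n by rewrite mulr_gt0// exprn_gt0.
have kq : iter m.+1 phi k = q by exact: iter_phiVK.
have near1 : \forall p \near k, B * rho ^+ m < rnorm (cocycle w phi m (iter m.+1 phi p)).
  by apply: near_rnorm_gt; rewrite kq.
have near2 : \forall p \near k, rnorm (cocycle w phi m.+1 (iter 0 phi p)) < (B * rho ^+ m.+1)^-1.
  by apply: near_rnorm_lt; rewrite -[X in _ < X]mul1r ltr_pdivlMr// mulrC.
have [D [x [cD Dx x0 Dtower DP]]] := small_tower m m.+1 (m + m) (filterI near1 near2).
have ineq := tower_inequality cov TE Tc (introT andP (conj r0 r1)) (ltW c0) rVr cD Dx Dtower.
have Bi n : 0 <= (B * rho ^+ n)^-1 by rewrite invr_ge0 ltW.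
have x_le : rnorm x <= C * eta ^+ m * ((B * rho ^+ m)^-1 * rnorm (bpow T m x)).
  apply: (le_trans (UC m x).2); rewrite ler_wpM2l ?mulr_ge0 ?exprn_ge0//; try lra.
  apply: (le_bpow_T cov TE cD Dx (Bi m)) => p /DP[]; rewrite iter_phiVK => h _.
  by rewrite mulrC ler_pdivlMr// mul1r ltW.
have Dm := supported_T cov TE m cD Dx.
have cDm := iter_preim_clopen phi m cD.
have T_le : rnorm (bpow T (m + m).+1 x) <=
    (B * rho ^+ m.+1)^-1 * (C * eta ^+ m.+1 * rnorm (bpow T m x)).
  rewrite -addSn bpowD.
  apply: (@le_trans _ _ ((B * rho ^+ m.+1)^-1 * rnorm (bpow U m.+1 (bpow T m x)))).
    apply: (bpow_T_le cov TE cDm Dm (Bi _)) => p /DP[_]; rewrite iter_phiK => h.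
    exact: ltW h.
  by rewrite ler_wpM2l//; exact: (UC _ _).1.
have Tm0 : 0 < rnorm (bpow T m x).
  rewrite lt_neqAle rnorm_ge0 andbT; apply/eqP => Tm0.
  by move: x_le; rewrite -Tm0 !mulr0 leNgt rnorm_gt0 x0.
have eta0 : 0 < eta by lra.
have e1 : r ^+ m.+1 * (C * eta ^+ m * (B * rho ^+ m)^-1) = C * r / B.
  rewrite /rho exprMn exprS.
  have rm : r ^+ m != 0 by rewrite expf_neq0// gt_eqF.
  have em : eta ^+ m != 0 by rewrite expf_neq0// gt_eqF.
  by field; rewrite rm em gt_eqF.
have e2 : r ^+ m * ((B * rho ^+ m.+1)^-1 * (C * eta ^+ m.+1)) = C * r^-1 / B.
  rewrite /rho exprMn !exprS.
  have rm : r ^+ m != 0 by rewrite expf_neq0// gt_eqF.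
  have em : eta ^+ m != 0 by rewrite expf_neq0// gt_eqF.
  by field; rewrite rm em !gt_eqF.
have : c / 2 * rnorm (bpow T m x) <= (C * r / B + C * r^-1 / B) * rnorm (bpow T m x).
  apply: (le_trans ineq); rewrite mulrDl lerD//.
    by rewrite -e1 -!mulrA ler_pM2l ?exprn_gt0// !mulrA; move: x_le; rewrite !mulrA.
  by rewrite -e2 -!mulrA ler_pM2l ?exprn_gt0// !mulrA; move: T_le; rewrite !mulrA.
rewrite ler_pM2r// -mulrDl -mulrDr ler_pdivlMr//.
have -> : c / 2 * B = C * (r + r^-1) + c / 2 by rewrite /B; field; rewrite !gt_eqF.
lra.
Qed.

(** Let $Ty-y=x$ with [x] supported in level [m] of a tower, and let $z_j$ be the part of [y] on
    level [j]. Then $T^mz_0=z_m+x$ and $T^nz_m=z_{m+n}$. A small $w_m$ makes $T^mz_0$ small and a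
    large $w_n$ makes $z_m$ small, so [x] would have at most half its own norm. *)
Lemma not_decay_and_growth (rho eta B : R) : resolvent_set T 1 ->
  0 < rho -> 1 < eta -> rho * eta < 1 -> 0 < B ->
  forall A, 0 < A -> exists N, forall m n q, (N <= m)%N -> (N <= n)%N ->
    rnorm (cocycle w phi m q) <= A * (B * rho ^+ m) ->
    ~ 1 <= A * (B * rho ^+ n) * rnorm (cocycle w phi n (iter n psi q)).
Proof.
move=> /resolvent_setP[[C' C'0 TC'] Ts] rho0 eta1 reta B0 A A0.
have [C C1 UC] := U_two_sided cov eta1.
have re0 : 0 < rho * eta by rewrite mulr_gt0//; lra.
have [N NP] := @pow_dominated R (2 * A * B * C * C') _ 1 re0 reta 4^-1 ltac:(lra).
(* [N.+1] forces [m] to be positive, which $T^mz_0=z_m+x$ requires. *)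
exists N.+1 => m n q Nm Nn wm wn.
set k := iter n psi q in wn.
(* The factor 2 makes the inequalities at [q] strict, so that they persist on a neighbourhood. *)
pose e j := 2 * A * (B * rho ^+ j).
have e0 j : 0 < e j by rewrite !mulr_gt0// exprn_gt0.
have e_small j : (N <= j)%N -> e j * (C * eta ^+ j) * C' <= 4^-1.
  move=> /NP; rewrite expr1n mulr1 exprMn; apply: le_trans.
  by rewrite le_eqVlt; apply/orP; left; apply/eqP; rewrite /e; ring.
have near1 : \forall p \near k, rnorm (cocycle w phi m (iter n phi p)) < e m.
  apply: near_rnorm_lt; rewrite iter_phiVK; apply: le_lt_trans wm _.
  by rewrite /e -!mulrA ltr_pMl ?mulr_gt0 ?exprn_gt0//; lra.
have near2 : \forall p \near k, (e n)^-1 < rnorm (cocycle w phi n (iter 0 phi p)).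
  apply: near_rnorm_gt => /=; rewrite -[X in X < _]mul1r ltr_pdivrMr//.
  apply: (le_lt_trans wn); rewrite mulrC ltr_pM2l//.
    by rewrite /e -!mulrA ltr_pMl ?mulr_gt0 ?exprn_gt0//; lra.
  rewrite lt_neqAle rnorm_ge0 andbT; apply/eqP => wn0.
  by move: wn; rewrite -wn0 mulr0 ler10.
clearbody e.
have [D [x0 [cD Dx0 x00 Dtower DP]]] := small_tower m n (m + n) (filterI near1 near2).
have cDj j := iter_preim_clopen phi j cD.
pose x := bpow U m x0.
have Dx : supported a (iter m phi @^-1` D) x.
  by rewrite /supported /x -(bpow_U_char cov)// Dx0.
have xgt0 : 0 < rnorm x.
  rewrite rnorm_gt0; apply: contra x00 => /eqP x0'.
  by rewrite -(bpow_UK cov m x0) -/x x0' linear0.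
have [y] := Ts x; rewrite scale1r => yx.
have y_le : rnorm y <= C' * rnorm x by rewrite -yx -{3}(scale1r y).
pose z j := a (char_fun (iter j phi @^-1` D)) y.
(* [T] carries the part of [y] on level [j] to the part of $Ty=y+x$ on level $j+1$. *)
have Tz j : T (z j) = z j.+1 + a (char_fun (iter j.+1 phi @^-1` D)) x.
  have Dj : iter 1 phi @^-1` (iter j phi @^-1` D) = iter j.+1 phi @^-1` D.
    by apply/seteqP; split=> p /=; rewrite -iterSr.
  have Tj : T (z j) = a (char_fun (iter 1 phi @^-1` (iter j phi @^-1` D))) (T y).
    exact: (T_char cov TE y 1 (cDj j)).
  by rewrite Tj Dj /z -linearD -yx addrC subrK.
have disj j : (j <= m + n)%N -> j != m -> a (char_fun (iter j phi @^-1` D)) x = 0.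
  move=> jN jm; apply: (act_char_disjoint (cDj m) (cDj j) _ Dx).
  by apply: (tower_disjoint Dtower) => //; rewrite ?leq_addr// eq_sym.
have Tz0 j : (j < m)%N -> bpow T j (z 0%N) = z j.
  elim: j => // j IH jm; rewrite bpowS IH ?(ltnW jm)// Tz disj ?addr0 ?ltn_eqF//.
  by rewrite (leq_trans (ltnW jm)) ?leq_addr.
have Tzm0 : bpow T m (z 0%N) = z m + x.
  case: (m) Nm Dx Tz0 => // j _ Dx' Tz0; rewrite bpowS Tz0// Tz.
  by rewrite Dx'.
have Tzm j : (j <= n)%N -> bpow T j (z m) = z (m + j)%N.
  elim: j => [|j IH] jn; first by rewrite addn0.
  rewrite bpowS IH ?(ltnW jn)// Tz addnS disj ?addr0//.
    by rewrite -addnS leq_add2l.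
  by rewrite gtn_eqF// ltnS leq_addr.
have z_le j : rnorm (z j) <= rnorm y by exact: act_char_le.
have bound1 : rnorm (bpow T m (z 0%N)) <= e m * (C * eta ^+ m * rnorm y).
  have Dz : supported a D (z 0%N) by exact: supported_act.
  apply: (@le_trans _ _ (e m * rnorm (bpow U m (z 0%N)))).
    apply: (bpow_T_le cov TE cD Dz (ltW (e0 m))) => p /DP[]; rewrite iter_phiVK => h _.
    exact: ltW.
  rewrite ler_pM2l// (le_trans (UC _ _).1)// ler_wpM2l// mulr_ge0 ?exprn_ge0//; lra.
have bound2 : rnorm (z m) <= C * eta ^+ n * (e n * rnorm y).
  have Dz : supported a (iter m phi @^-1` D) (z m) by exact: supported_act.
  have Ce0 : 0 <= C * eta ^+ n by rewrite mulr_ge0 ?exprn_ge0//; lra.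
  apply: (le_trans (UC n _).2); rewrite ler_wpM2l//.
  apply: (@le_trans _ _ (e n * rnorm (bpow T n (z m)))); last by rewrite Tzm// ler_pM2l.
  apply: (le_bpow_T cov TE (cDj m) Dz (ltW (e0 n))) => p /DP[_]; rewrite iter_phiK => h.
  by rewrite mulrC -ler_pdivrMr// mul1r ltW.
have xz : rnorm x <= rnorm (bpow T m (z 0%N)) + rnorm (z m).
  by rewrite (_ : rnorm x = rnorm (bpow T m (z 0%N) - z m)) ?rnormB// Tzm0 addrC addKr.
have e_small' j : (N <= j)%N -> e j * (C * eta ^+ j * rnorm y) <= 4^-1 * rnorm x.
  move=> Nj; apply: (@le_trans _ _ (e j * (C * eta ^+ j) * C' * rnorm x)).
    have [C0 eta0] : 0 < C /\ 0 < eta by lra.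
    by rewrite -!mulrA ler_pM2l ?e0// ler_pM2l// ler_pM2l ?exprn_gt0.
  by rewrite ler_pM2r// e_small.
have := e_small' m (ltnW Nm); have := e_small' n (ltnW Nn).
move: bound2; rewrite mulrCA.
by lra.
Qed.

End dichotomy.

(** * The resolvent set in terms of the weight and the homeomorphism *)

Section characterization.
Context {R : realType} {K : compactHausdorffType} {V : normedModType R[i]}.
Variables (a : CK_action K V) (phi : homeomorphism K K) (U Uinv : 'L(V)).
Hypothesis cov : covariant a phi U Uinv.
Hypothesis edK : extremally_disconnected K.
Hypothesis aper : forall k, ~ periodic_point phi k.

Let psi := homeo_inv phi.

(** [E] is defined by decay at the single time [N]. The preceding two lemmas make decay forwards and
    growth backwards complementary, and their incompatibility holds even with the extra factor [A];
    so decay at any one time from [N] on, up to this factor, already places a point in [E]. *)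
Lemma hyperbolic_resolvent1 (w : CK R K) (T : 'L(V)) : (forall x, T x = a w (U x)) ->
  resolvent_set T 1 -> hyperbolic w phi.
Proof.
move=> TE T1.
have [rho [eta [B [/andP[rho0 rho1] eta1 reta B0 cover]]]] := decay_or_growth cov TE edK aper T1.
pose M := 1 + supnorm w.
have M1 : 1 <= M by rewrite lerDl supnorm_ge0.
have wM k : rnorm (w k) <= M by rewrite (le_trans (le_supnorm w k))// lerDr.
(* One step along the orbit changes the cocycle by a factor at most [M] and the threshold [e] by
   [rho]; [A] is the slack for such a step. *)
pose A := M / rho.
have rV1 : 1 < rho^-1 by rewrite invf_gt1.
have A1 : M <= A by rewrite /A ler_peMr//; lra.
have A0 : 0 < A by lra.
have [N NP] := not_decay_and_growth cov TE edK aper T1 rho0 eta1 reta B0 A0.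
pose e n := B * rho ^+ n.
have e0 n : 0 < e n by rewrite mulr_gt0// exprn_gt0.
have eS n : e n.+1 = rho * e n by rewrite /e exprS mulrCA.
pose E := [set q | rnorm (cocycle w phi N q) <= e N].
pose F n := [set q | 1 <= e n * rnorm (cocycle w phi n (iter n psi q))].
have {}cover m q : ~ rnorm (cocycle w phi m q) <= e m -> F m.+1 q.
  by move=> /negP; rewrite -ltNge => /cover.
have {}NP m n q : (N <= m)%N -> (N <= n)%N -> rnorm (cocycle w phi m q) <= A * e m ->
    1 <= A * e n * rnorm (cocycle w phi n (iter n psi q)) -> False.
  by move=> Nm Nn; exact: NP Nm Nn.
have leA n : e n <= A * e n by rewrite ler_peMl//; [exact: ltW|lra].
have FA n q : F n q -> 1 <= A * e n * rnorm (cocycle w phi n (iter n psi q)).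
  by move=> Fq; rewrite (le_trans Fq)// ler_wpM2r ?rnorm_ge0.
have weakE m q : (N <= m)%N -> rnorm (cocycle w phi m q) <= A * e m -> E q.
  move=> Nm wm; have [//|/cover/FA Fq] := pselect (E q).
  by have := NP m N.+1 q Nm (leqnSn _) wm Fq.
have weakF n q : (N <= n)%N -> 1 <= A * e n * rnorm (cocycle w phi n (iter n psi q)) -> ~ E q.
  by move=> Nn wn Eq; apply: (NP N n q (leqnn _) Nn _ wn); exact: le_trans Eq (leA N).
have EP m q : (N <= m)%N -> E q -> rnorm (cocycle w phi m q) <= e m.
  move=> Nm Eq; have [//|/cover/FA] := pselect (rnorm (cocycle w phi m q) <= e m).
  by move=> /(weakF _ _ (leqW Nm)).
have cE : clopen E.
  split.
    (* [E] is closed by definition. It is open because it is also the set where growth at time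
       [N.+1] fails, a strict inequality. *)
    rewrite (_ : E = [set q | rnorm (cocycle w phi N.+1 (iter N.+1 psi q)) < (e N.+1)^-1]).
      apply: (@open_comp _ _ (fun q => rnorm (cocycle w phi N.+1 (iter N.+1 psi q)))
        [set x | x < (e N.+1)^-1]); last exact: open_lt.
      move=> q _; apply: (@continuous_comp _ _ _ (iter N.+1 psi)
        (fun q => rnorm (cocycle w phi N.+1 q))).
        by apply: iter_continuous; exact: homeo_inv_continuous.
      exact: CK_rnorm_continuous.
    apply/seteqP; split=> q /=.
      move=> Eq; rewrite ltNge; apply/negP => Fq; apply: (weakF N.+1 q (leqnSn _) _ Eq).
      by apply: FA; rewrite /F /= mulrC -ler_pdivrMr// mul1r.
    move=> Fq; have [//|/cover] := pselect (E q); rewrite /F /= mulrC -ler_pdivrMr// mul1r.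
    by rewrite leNgt Fq.
  apply: (@preimage_closed _ _ (fun q => rnorm (cocycle w phi N q)) [set x | x <= e N]).
    by move=> q _; exact: CK_rnorm_continuous.
  exact: closed_le.
have Ephi k : E (phi k) <-> E k.
  split=> Ek.
    apply: (weakE N.+1 k (leqnSn _)); rewrite cocycleS rnormM eS /A mulrA divfK ?gt_eqF//.
    by rewrite ler_pM ?rnorm_ge0.
  have [//|/cover Fk] := pselect (E (phi k)).
  exfalso; apply: (weakF N k (leqnn _) _ Ek).
  have ks : iter N.+1 psi (phi k) = iter N psi k by rewrite iterSr /psi homeo_funK.
  have {}Fk : 1 <= e N.+1 * rnorm (cocycle w phi N.+1 (iter N.+1 psi (phi k))) := Fk.
  rewrite ks cocycleSr iter_phiVK rnormM eS in Fk.
  rewrite (le_trans Fk)// [rnorm _ * rnorm _]mulrC mulrA ler_wpM2r ?rnorm_ge0//.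
  rewrite mulrAC ler_pM2r// (le_trans _ A1)// (le_trans _ (wM k))//.
  by rewrite ler_piMl ?rnorm_ge0// ltW.
exists E; split=> //; exists B, rho, N.+1; split=> //; first by rewrite rho0.
move=> n k Nn; split=> [Ek|nEk]; first by apply: EP => //; exact: ltnW.
have nE : ~ E (iter n phi k) by move=> /(iter_invariant Ephi).
case: n Nn nE => // n Nn nE.
(* Since $\varphi^{n+1}(k)$ is off [E], $w_n$ does not decay there, and the dichotomy returns growth
   of $w_{n+1}$ at $\varphi^{-(n+1)}$ of that point, which is [k]. *)
have : ~ rnorm (cocycle w phi n (iter n.+1 phi k)) <= e n.
  move=> h; apply/nE/(weakE n) => //; exact: le_trans h (leA n).
by move=> /cover; rewrite /F /= -iterS iter_phiK.
Qed.

Lemma resolvent_set_scale (T1 T2 : 'L(V)) (c l1 l2 : R[i]) : c != 0 ->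
  (forall x, T2 x - l2 *: x = c *: (T1 x - l1 *: x)) ->
  resolvent_set T1 l1 -> resolvent_set T2 l2.
Proof.
move=> c0 T12 /resolvent_setP[[C C0 TC] Ts].
have rc : 0 < rnorm (c : R[i]^o) by rewrite rnorm_gt0.
apply/resolvent_setP; split=> [|y].
  exists (C / rnorm (c : R[i]^o)) => [|x]; first by rewrite divr_gt0.
  by rewrite T12 rnormZ mulrA divfK ?gt_eqF.
have [x Tx] := Ts (c^-1 *: y); exists x.
by rewrite T12 Tx scalerA divff// scale1r.
Qed.

(** The right side mentions neither the space nor [U], so any two covariant actions with the same
    [w] and [phi] have the same resolvent set. For [l] nonzero, dividing by [l] reduces to 1. *)
Lemma resolvent_setE (w : CK R K) (T : 'L(V)) l : geometrically_complete V ->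
  (forall x, T x = a w (U x)) ->
  resolvent_set T l <-> if l == 0 then forall k, w k != 0 else hyperbolic (l^-1 *: w) phi.
Proof.
move=> cV TE; have [->|l0] := eqVneq l 0; first exact: (resolvent0P cov TE edK).
pose T1 := comp_bop (a (l^-1 *: w)) U.
have T1E x : T1 x = l^-1 *: T x by rewrite /= actZ TE.
have TT1 : resolvent_set T l <-> resolvent_set T1 1.
  split; [apply: (resolvent_set_scale (c := l^-1))|apply: (resolvent_set_scale (c := l))];
    rewrite ?invr_eq0// => x; rewrite T1E scalerBr !scalerA.
    by rewrite mulVf.
  by rewrite divff// scale1r mulr1.
rewrite TT1; split=> [|h]; first exact: hyperbolic_resolvent1.
exact: (resolvent1_hyperbolic cov (w := l^-1 *: w)).
Qed.

End characterization.

(** * The two actions *)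

Section CK_self_action.
Context {R : realType} {K : compactHausdorffType}.
Implicit Types (f g x : CK R K) (phi : homeomorphism K K).

(** Lets multiplication by [f] on $C(K)$ be the weighted composition operator [wcomp f homeo_id],
    already known to be bounded. *)
Definition homeo_id : homeomorphism K K :=
  @Homeomorphism K K idfun idfun (fun=> erefl) (fun=> erefl)
    (@idfun_continuous K) (@idfun_continuous K).

Definition homeo_sym phi : homeomorphism K K :=
  @Homeomorphism K K (homeo_inv phi) phi (@homeo_invK _ _ phi) (@homeo_funK _ _ phi)
    (@homeo_inv_continuous _ _ phi) (@homeo_continuous _ _ phi).

Lemma wcomp_contractive w phi f : rnorm (wcomp w phi f) <= supnorm w * rnorm f.
Proof.
apply: supnorm_le => [|k]; first by rewrite mulr_ge0 ?supnorm_ge0.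
by rewrite (rnormM (w k) (f (phi k))) ler_pM ?rnorm_ge0 ?le_supnorm.
Qed.

Lemma wcomp_faithful f : (forall g, wcomp f homeo_id g = 0) -> f = 0.
Proof. by move=> /(_ 1) <-; apply: CKP => k; rewrite -[LHS]mulr1. Qed.

Lemma wcompD f g x : wcomp (f + g) homeo_id x = wcomp f homeo_id x + wcomp g homeo_id x.
Proof.
apply: CKP => k; change ((f k + g k) * x k = f k * x k + g k * x k :> R[i]).
exact: mulrDl.
Qed.

Lemma wcompM f g x : wcomp (f * g) homeo_id x = wcomp f homeo_id (wcomp g homeo_id x).
Proof.
apply: CKP => k; change (f k * g k * x k = f k * (g k * x k) :> R[i]).
by rewrite mulrA.
Qed.

Lemma wcompZ (c : R[i]) f x : wcomp (c *: f) homeo_id x = c *: wcomp f homeo_id x.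
Proof.
apply: CKP => k; change (c * f k * x k = c * (f k * x k) :> R[i]).
by rewrite mulrA.
Qed.

Lemma wcomp1 x : wcomp 1 homeo_id x = x.
Proof. by apply: CKP => k; change (1 * x k = x k :> R[i]); rewrite mul1r. Qed.

Definition CK_self_action : CK_action K (CK R K) :=
  @CKAction R K (CK R K) (fun f => wcomp f homeo_id) wcompD wcompM wcomp1 wcompZ
    (fun f => wcomp_contractive f homeo_id) wcomp_faithful.

Lemma comp_CK_subexponential phi : subexponential (wcomp 1 phi : 'L(CK R K)).
Proof.
move=> r r1; exists 1 => // n x; rewrite mul1r.
apply: (@le_trans _ _ (rnorm x)); last first.
  by rewrite ler_peMl ?rnorm_ge0// exprn_ege1// ltW.
elim: n => // n IH; rewrite bpowS; apply: le_trans IH.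
rewrite (le_trans (wcomp_contractive _ _ _))// ler_piMl ?rnorm_ge0//.
by apply: supnorm_le => // k; rewrite -[X in _ <= X](@rnorm1 R).
Qed.

Lemma CK_self_covariant phi :
  covariant CK_self_action phi (wcomp 1 phi) (wcomp 1 (homeo_sym phi)).
Proof.
split.
- split=> f; apply: CKP => k.
    change (1 * (1 * f (phi (homeo_inv phi k))) = f k :> R[i]).
    by rewrite !mul1r homeo_invK.
  change (1 * (1 * f (homeo_inv phi (phi k))) = f k :> R[i]).
  by rewrite !mul1r homeo_funK.
- move=> f x; apply: CKP => k.
  change (1 * (f (phi k) * (1 * x (homeo_inv phi (phi k)))) = f (phi k) * x k :> R[i]).
  by rewrite !mul1r homeo_funK.
- exact: comp_CK_subexponential.
- exact: comp_CK_subexponential.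
Qed.

End CK_self_action.

(** * The module action and operators with spectrum in the unit circle *)

Section CK_module_action.
Context {R : realType} {K : compactHausdorffType} {X : completeNormedModType R[i]}.

Lemma opnorm_le (T : 'L(X)) x : rnorm (T x) <= opnorm T * rnorm x.
Proof.
have [->|x0] := eqVneq x 0; first by rewrite linear0 !rnorm0 mulr0.
have rx : 0 < rnorm x by rewrite rnorm_gt0.
have [C C0 TC] := bop_bounded T.
pose y := ((rnorm x)^-1)%:C *: x.
have y1 : rnorm y = 1 by rewrite rnormZ rnorm_real gtr0_norm ?invr_gt0// mulVf// gt_eqF.
rewrite -ler_pdivrMr// mulrC.
have -> : (rnorm x)^-1 * rnorm (T x) = rnorm (T y).
  by rewrite linearZ rnormZ rnorm_real gtr0_norm// invr_gt0.
apply: ub_le_sup; last by exists y => //=; rewrite rnormE y1.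
exists C => _ [z /= z1 <-]; rewrite (le_trans (TC z))// ler_piMr ?(ltW C0)//.
by rewrite ler_rnorm.
Qed.

Variable m : CK_module K X.

Lemma ckact_contractive f x : rnorm (m f x) <= supnorm f * rnorm x.
Proof. by rewrite -(ckact_isometric m) opnorm_le. Qed.

Lemma ckact_faithful f : (forall x, m f x = 0) -> f = 0.
Proof.
move=> mf0; apply/normr0_eq0; rewrite CK_normE.
suff -> : supnorm f = 0 by [].
apply/eqP; rewrite eq_le supnorm_ge0 andbT -(ckact_isometric m).
apply: ge_sup => [|_ [x _ <-]]; last by rewrite mf0 rnorm0.
by exists (rnorm (m f 0)); exists 0 => //=; rewrite normr0.
Qed.

Definition CK_module_action : CK_action K X :=
  @CKAction R K X m (ckactD m) (ckactM m) (ckact1 m) (ckactZ m) ckact_contractive ckact_faithful.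

Variables U Uinv : 'L(X).
Hypothesis hU : bop_inverse U Uinv.
Hypothesis sU : spectrum U `<=` [set z : R[i] | `|z| = 1].

Lemma resolvent_off_circle l : rnorm (l : R[i]^o) != 1 -> resolvent_set U l.
Proof.
move=> l1; apply/not_notP => /sU /= ln.
by move: l1; rewrite /rnorm ln eqxx.
Qed.

Lemma subexponential_off_circle : subexponential U.
Proof.
by apply: spectral_growth => l l1; apply: resolvent_off_circle; rewrite gt_eqF.
Qed.

(** The identity $U^{-1}-l=-l(U-l^{-1})U^{-1}$ turns points outside the unit disc into points inside
    it, which also lie off the spectrum of [U]. *)
Lemma inverse_subexponential_off_circle : subexponential Uinv.
Proof.
apply: spectral_growth => l l1; have [UK UinvK] := hU.
have l0 : l != 0 by apply: contraTneq l1 => ->; rewrite rnorm0 ltr10.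
have rl0 : 0 < rnorm (l : R[i]^o) by lra.
have /resolvent_setP[[C C0 UC] Us] : resolvent_set U l^-1.
  apply: resolvent_off_circle; rewrite rnormV lt_eqF//.
  by rewrite invf_lt1.
have key x : Uinv x - l *: x = - l *: (U (Uinv x) - l^-1 *: Uinv x).
  by rewrite UinvK scalerBr scalerA mulNr divff// !scaleNr scale1r opprK addrC.
apply/resolvent_setP; split=> [|y].
  have [D D0 UD] := bop_bounded U.
  exists (D * C) => [|x]; first exact: mulr_gt0.
  rewrite -{1}(UinvK x) (le_trans (UD _))// -mulrA ler_pM2l//.
  rewrite (le_trans (UC _))// ler_pM2l// key rnormZ rnormN.
  by rewrite ler_peMl ?rnorm_ge0// ltW.
have [u uy] := Us (- l^-1 *: y); exists (U u).
by rewrite key UK uy scalerA mulrNN divff// scale1r.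
Qed.

End CK_module_action.

Theorem theorem5p2 (R : realType) (K : compactHausdorffType)
  (X : completeNormedModType R[i]) (m : CK_module K X)
  (U Uinv : 'L(X)) (w : CK R K) (phi : homeomorphism K K)
  (hX : Kaplansky_module m)
  (hU : d_isomorphism m U)
  (hUinv : bop_inverse U Uinv)
  (hspec : spectrum U `<=` [set z : R[i] | `|z| = 1])
  (hphi : forall (f : CK R K) (x : X),
     U (m f (Uinv x)) = m (comp_CK f phi) x)
  (haper : forall k : K, ~ periodic_point phi k) :
  spectrum (comp_bop (m w) U) = spectrum (wcomp w phi).
Proof.
have covX : covariant (CK_module_action m) phi U Uinv.
  split=> //; first exact: subexponential_off_circle.
  exact: (inverse_subexponential_off_circle hUinv hspec).
have covK := @CK_self_covariant R K phi.
have [edK _] := hX.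
(* The operator on $C(K)$ is [w] times the composition operator, the same form as $T=wU$, so both
   spectra are described by one criterion. *)
have wcompE f : wcomp w phi f = CK_self_action w (wcomp 1 phi f).
  apply: CKP => k; change (w k * f (phi k) = w k * (1 * f (phi k)) :> R[i]).
  by rewrite mul1r.
have EX l := resolvent_setE covX edK haper (w := w) (T := comp_bop (m w) U) l
  (@Banach_geometrically_complete _ X) (fun=> erefl).
have EK l := resolvent_setE covK edK haper l (@CK_geometrically_complete R K) wcompE.
rewrite /spectrum; congr (~` _); apply/seteqP.
by split=> l => [/EX /EK|/EK /EX].
Qed.
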